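(* There is no Borel measurable map $\mathscr W\colon\mathcal D_{\mathsf{per}}\to\mathcal E_{\mathsf{per}}$, $\Lambda\mapsto\mathscr W_\Lambda$, that is equivariant, i.e. $\mathscr W_{T_w\Lambda}=T_w\mathscr W_\Lambda$ for all $\Lambda\in\mathcal D_{\mathsf{per}}$, $w\in\mathbb C$, and that satisfies $Z\circ\mathscr W=\mathrm{id}_{\mathcal D_{\mathsf{per}}}$.
   Context: $\mathcal E$ is the space of entire functions of one complex variable that do not vanish identically, with the topology of uniform convergence on compact sets. $\mathcal D$ is the space of (positive) divisors in $\mathbb C$, i.e. discrete (locally finite) multisets in $\mathbb C$, each identified with the corresponding integer-valued Radon counting measure, with the topology of vague convergence of Radon measures. Both are Polish spaces and carry their Borel $\sigma$-algebras; subsets carry the inherited Borel structure. The map $Z\colon\mathcal E\to\mathcal D$ assigns to $F$ its zero set counted with multiplicities. The additive group $\mathbb C$ acts on $\mathcal E$ by $T_wF(z)=F(z+w)$ and on $\mathcal D$ by $T_w\Lambda=\Lambda-w$. $\mathcal E_{\mathsf{per}}\subset\mathcal E$ and $\mathcal D_{\mathsf{per}}\subset\mathcal D$ denote the one-periodic parts (the case of one independent period): an element $x$ of $\mathcal E$ (respectively $\mathcal D$) belongs to $\mathcal E_{\mathsf{per}}$ (respectively $\mathcal D_{\mathsf{per}}$) iff its group of periods $\{w\in\mathbb C: T_wx=x\}$ is infinite cyclic, i.e. equals $\mathbb Z\tau$ for some $\tau\in\mathbb C\setminus\{0\}$. *)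

(* Defs.v *)
From HB Require Import structures.
From mathcomp Require Import all_boot all_order all_algebra complex.
From mathcomp Require Import all_classical all_reals all_analysis.
Import Order.TTheory GRing.Theory Num.Theory numFieldNormedType.Exports.
Set Implicit Arguments.
Unset Strict Implicit.
Unset Printing Implicit Defensive.
Local Open Scope classical_set_scope.
Local Open Scope ring_scope.

(* R[i] seen as a numClosedFieldType, so that it inherits the topology and the
   normed-module structure over itself that MathComp-Analysis puts on every
   such field; `derivable F z 1` is then complex differentiability at z. *)
Definition Cplx (R : realType) : numClosedFieldType := R[i].

Definition borel (X : topologicalType) : set (set X) := <<s @open X >>.

(* The Borel structure that a subset A of X inherits from X: the traces on A
   of the Borel sets of X. *)
Definition inherited_borel (X : topologicalType) (A : set X) : set (set A) :=
  preimage_set_system [set: A] set_val (@borel X).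

Definition borel_map (X Y : topologicalType) (A : set X) (B : set Y)
    (f : A -> B) : Prop :=
  forall S : set B, inherited_borel S -> inherited_borel (f @^-1` S).

Definition one_periodic (R : realType) (X : Type) (T : Cplx R -> X -> X)
    (x : X) : Prop :=
  exists2 tau : Cplx R, tau != 0 &
    [set w | T w x = x] = range (fun n : int => tau *~ n).

Lemma one_periodic_act (R : realType) (X : Type) (T : Cplx R -> X -> X)
    (w : Cplx R) (x : X) :
    (forall v v' y, T v (T v' y) = T v' (T v y)) -> injective (T w) ->
  one_periodic T x -> one_periodic T (T w x).
Proof.
move=> TC Tinj [tau tau0 perx]; exists tau => //; rewrite -perx.
by apply/seteqP; split=> v /=; rewrite TC; [exact: Tinj|move=> ->].
Qed.

Section EntireFunctions.
Variable R : realType.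
Local Notation C := (Cplx R).

Definition entire (F : C -> C) : Prop := forall z, derivable F z 1.

Lemma entire_shift (w : C) (F : C -> C) :
  entire F -> entire (fun z => F (z + w)).
Proof.
move=> eF z; have := eF (z + w); rewrite /derivable /=.
by under eq_fun do rewrite addrA.
Qed.

Definition nonzero_entire : set {family compact, C -> C} :=
  [set F | entire F /\ exists z, F z != 0].

(* The entire functions that do not vanish identically, with the subspace
   topology of the topology of uniform convergence on compact sets. *)
Definition Efun : topologicalType := set_type nonzero_entire.

Definition Efun_val (F : Efun) : C -> C := \val F.

Definition shiftE_fun (w : C) (F : Efun) : C -> C := fun z => Efun_val F (z + w).

Lemma shiftE_subproof (w : C) (F : Efun) : shiftE_fun w F \in nonzero_entire.
Proof.
have [eF [z Fz0]] := set_mem (valP F); apply/mem_set; split.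
  exact: entire_shift.
by exists (z - w); rewrite /shiftE_fun subrK.
Qed.

Definition shiftE (w : C) (F : Efun) : Efun :=
  exist _ (shiftE_fun w F) (shiftE_subproof w F).

Lemma shiftE_comm (v w : C) (F : Efun) :
  shiftE v (shiftE w F) = shiftE w (shiftE v F).
Proof.
by apply/val_inj/funext => z /=; rewrite /shiftE_fun /Efun_val /= /shiftE_fun addrAC.
Qed.

Lemma shiftE_inj (w : C) : injective (shiftE w).
Proof.
move=> F G FG; apply/val_inj/funext => z.
have := congr1 (fun H : Efun => Efun_val H (z - w)) FG.
by rewrite /Efun_val /= /shiftE_fun subrK.
Qed.

Definition Eper : set Efun := [set F | one_periodic shiftE F].

Lemma shiftEper_subproof (w : C) (F : Eper) : shiftE w (set_val F) \in Eper.
Proof.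
apply/mem_set/one_periodic_act; first exact: shiftE_comm.
  exact: shiftE_inj.
exact: set_mem (valP F).
Qed.

Definition shiftEper (w : C) (F : Eper) : Eper :=
  exist _ (shiftE w (set_val F)) (shiftEper_subproof w F).

End EntireFunctions.

Arguments Efun R : clear implicits.
Arguments Eper R : clear implicits.

Section Divisors.
Variable R : realType.
Local Notation C := (Cplx R).

Record divisor := Divisor {
  multiplicity :> C -> nat;
  locally_finite : forall K : set C, compact K ->
    finite_set (K `&` [set a | multiplicity a != 0%N])
}.

HB.instance Definition _ := gen_eqMixin divisor.
HB.instance Definition _ := gen_choiceMixin divisor.

Lemma divisor_eq (L M : divisor) : (forall a, L a = M a) -> L = M.
Proof.
case: L M => [L Lf] [M Mf] /= LM.
have {}LM : L = M by exact/funext.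
by case: _ / LM in Mf *; congr Divisor; exact: Prop_irrelevance.
Qed.

Lemma divisor0_subproof (K : set C) : compact K ->
  finite_set (K `&` [set a : C | 0%N != 0%N]).
Proof.
by move=> _; rewrite (_ : _ `&` _ = set0) // -subset0 => a [].
Qed.

Definition divisor0 : divisor := Divisor divisor0_subproof.

Definition borelC : measurableType _ := g_sigma_algebraType (@open C).

Definition counting_measure (L : divisor) (A : set borelC) : \bar R :=
  (\esum_(a in A) (L a)%:R%:E)%E.

Section counting_measure.
Variable L : divisor.

Let cm0 : counting_measure L set0 = 0%E.
Proof. exact: esum_set0. Qed.

Let cm_ge0 A : (0 <= counting_measure L A)%E.
Proof. by apply: esum_ge0 => a _; rewrite -[0%E]/(0%:E) lee_fin ler0n. Qed.

Let cm_sigma_additive : semi_sigma_additive (counting_measure L).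
Proof.
move=> F _ tF _; rewrite /counting_measure.
rewrite nneseries_sum_bigcup //.
by apply: is_cvg_nneseries => n _ _; exact: cm_ge0.
Qed.

HB.instance Definition _ := isMeasure.Build _ _ _ (counting_measure L)
  cm0 cm_ge0 cm_sigma_additive.

End counting_measure.

Definition test_function : Type :=
  {phi : C -> R | continuous phi /\ compact (closure [set z | phi z != 0])}.

Definition vague_pairing (L : divisor) : {ptws test_function -> R} :=
  fun phi => \int[counting_measure L]_(z in [set: borelC]) sval phi z.

(* Vague topology: the coarsest one making all the pairings continuous. *)
HB.instance Definition _ :=
  Topological.copy divisor (initial_topology vague_pairing).

Lemma shiftD_subproof (w : C) (L : divisor) (K : set C) : compact K ->
  finite_set (K `&` [set a | L (a + w) != 0%N]).
Proof.
move=> cK; have cKw : compact [set a + w | a in K].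
  apply: continuous_compact => //; apply: continuous_subspaceT => a.
  by apply: (@cvgD C C C (nbhs a) _ (fun x => x) (fun=> w) a w);
    [exact: cvg_id|exact: cvg_cst].
have := finite_image (fun a => a - w) (locally_finite L cKw).
apply: sub_finite_set => a [Ka La]; exists (a + w); last by rewrite addrK.
by split => //; exists a.
Qed.

(* L - w: the multiplicity of a in L - w is that of a + w in L. *)
Definition shiftD (w : C) (L : divisor) : divisor :=
  Divisor (shiftD_subproof w L).

Lemma shiftD_comm (v w : C) (L : divisor) :
  shiftD v (shiftD w L) = shiftD w (shiftD v L).
Proof. by apply: divisor_eq => a /=; rewrite addrAC. Qed.

Lemma shiftD_inj (w : C) : injective (shiftD w).
Proof.
move=> L M LM; apply: divisor_eq => a.
by have := congr1 (fun N : divisor => N (a - w)) LM; rewrite /= subrK.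
Qed.

Definition Dper : set divisor := [set L | one_periodic shiftD L].

Lemma shiftDper_subproof (w : C) (L : Dper) : shiftD w (set_val L) \in Dper.
Proof.
apply/mem_set/one_periodic_act; first exact: shiftD_comm.
  exact: shiftD_inj.
exact: set_mem (valP L).
Qed.

Definition shiftDper (w : C) (L : Dper) : Dper :=
  exist _ (shiftD w (set_val L)) (shiftDper_subproof w L).

End Divisors.

Arguments Dper R : clear implicits.

Section ZeroSet.
Variable R : realType.
Local Notation C := (Cplx R).

Definition vanishing_order (F : C -> C) (a : C) (n : nat) : Prop :=
  exists G : C -> C,
    [/\ entire G, G a != 0 & forall z, F z = (z - a) ^+ n * G z].

Lemma vanishing_order_uniq (F : C -> C) (a : C) (m n : nat) :
  vanishing_order F a m -> vanishing_order F a n -> m = n.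
Proof.
wlog mn : m n / (m <= n)%N.
  move=> H Hm Hn; case/orP: (leq_total m n) => [mn|nm]; first exact: H.
  by apply/esym/H.
move=> [G [eG Ga FG]] [H [eH Ha FH]].
apply/eqP; rewrite eqn_leq mn /= leqNgt; apply/negP => ltmn.
have cG : {for a, continuous G}.
  by apply/differentiable_continuous/derivable1_diffP; exact: eG.
have cH : {for a, continuous H}.
  by apply/differentiable_continuous/derivable1_diffP; exact: eH.
have GH z : z != a -> G z = (z - a) ^+ (n - m) * H z.
  move=> za; have za0 : (z - a) ^+ m != 0 by rewrite expf_neq0 // subr_eq0.
  by apply: (mulfI za0); rewrite -FG FH mulrA -exprD subnKC.
have lim1 : G z @[z --> a^'] --> G a by exact: cvg_within_filter cG.
have lim2 : (z - a) ^+ (n - m) * H z @[z --> a^'] --> (a - a) ^+ (n - m) * H a.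
  have c1 : (fun z : C => z - a) @ a --> a - a.
    by apply: (@cvgB C C C (nbhs a) _ (fun z => z) (fun=> a));
      [exact: cvg_id|exact: cvg_cst].
  have c2 k : (fun z : C => (z - a) ^+ k) @ a --> (a - a) ^+ k.
    elim: k => [|k IHk]; first exact: (@cvg_cst C (1 : C) C (nbhs a) _).
    under eq_fun do rewrite exprS.
    by rewrite exprS; exact: (@cvgM C C (nbhs a) _ _ _ _ _ c1 IHk).
  apply: cvg_within_filter.
  exact: (@cvgM C C (nbhs a) _ _ _ _ _ (c2 _) cH).
move: lim2; rewrite subrr expr0n subn_eq0 leqNgt ltmn /= mul0r => lim2.
have lim3 : G z @[z --> a^'] --> (0 : C).
  apply: cvg_trans lim2; apply: near_eq_cvg; near=> z; rewrite GH //.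
  by near: z; exact: nbhs_dnbhs_neq.
by move: Ga; rewrite (cvg_unique _ lim1 lim3) ?eqxx.
Unshelve. all: by end_near. Qed.

Definition is_zero_divisor (F : C -> C) (L : divisor R) : Prop :=
  forall a, vanishing_order F a (L a).

(* By the identity theorem every F in Efun has exactly one zero divisor, so the
   default value divisor0 is never used; moreover divisor0 is not in Dper, so
   Z F = L with L in Dper always means that L is the zero divisor of F. *)
Definition Z (F : Efun R) : divisor R :=
  xget (divisor0 R) [set L | is_zero_divisor (Efun_val F) L].

Lemma ZE (F : Efun R) (L : divisor R) :
  is_zero_divisor (Efun_val F) L -> Z F = L.
Proof.
move=> FL; apply: xget_unique => // M FM.
by apply: divisor_eq => a; exact: vanishing_order_uniq (FM a) (FL a).
Qed.

End ZeroSet.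

(* Main.v *)
Require Import Defs.
From mathcomp Require Import all_boot all_order all_algebra.
From mathcomp Require Import all_classical all_reals all_analysis.
From mathcomp Require Import measurable_realfun complex ring lra zify.
Import Order.TTheory GRing.Theory Num.Theory numFieldNormedType.Exports.
Set Implicit Arguments.
Unset Strict Implicit.
Unset Printing Implicit Defensive.
Local Open Scope classical_set_scope.
Local Open Scope ring_scope.

(** For real b, let Lambda_b = (Z + iZ) + 2 (Z + i (Z + b) / sqrt 2). Its group
    of periods is Z, it depends continuously on b, and shifting it by i k gives
    Lambda_(b + l - k sqrt 2) for every integer l. If W existed, the function
    F_b = W(Lambda_b) would have period 1, so that for each level y without zeros
    the loop x |-> F_b(x + i y), -1/2 <= x <= 1/2, would have a winding number
    around 0. Its parity at y = 1/2 depends on F_b in a locally constant way,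
    hence on b in a Borel way. Between the levels 1/2 and 1/2 + k the parity
    changes by the number of zeros in between, that is by k modulo 2; by
    equivariance, the parities at b and at b + l - k sqrt 2 are opposite when k is
    odd. As the numbers l - k sqrt 2 with k odd come arbitrarily close to 0, the
    Baire property forces the sets of b with even and with odd parity both to be
    meager, although they cover an interval.

    The parity of a winding number is read off from a continuous square root
    along the loop. This makes the argument principle modulo 2 a statement about
    continuous functions, and no complex integration is needed. *)

(** * Baire property of Borel sets *)

Section BaireProperty.
Variable X : topologicalType.
Implicit Types (A B G Q : set X).

(** Phrased with a sequence of open dense sets because this is the form in which the Baire category
    theorem [Baire] consumes it. *)
Definition comeager G : Prop := exists U : (set X)^nat,
  (forall n, open (U n) /\ dense (U n)) /\ \bigcap_n U n `<=` G.

Lemma comeager_sub A B : A `<=` B -> comeager A -> comeager B.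
Proof. by move=> AB [U [oU UA]]; exists U; split=> // x /UA/AB. Qed.

Lemma comeager_open_dense Q : open Q -> dense Q -> comeager Q.
Proof. by move=> oO dO; exists (fun=> Q); split=> // x /(_ 0%N I). Qed.

Lemma comeager_bigcap (G : (set X)^nat) :
  (forall n, comeager (G n)) -> comeager (\bigcap_n G n).
Proof.
move=> /choice[U UG].
(* The double sequence is enumerated through codes of pairs; a number that codes no pair gets the
   whole space. *)
exists (fun k => if unpickle k is Some nm then U nm.1 nm.2 else setT).
split=> [k|x Ux n _].
  case: unpickle => [[n m]|]; first exact: (UG n).1.
  by split; [exact: openT|move=> Q O0 _; rewrite setIT].
by apply: (UG n).2 => m _; have := Ux (pickle (n, m)) I; rewrite pickleK.
Qed.

Lemma comeagerI A B : comeager A -> comeager B -> comeager (A `&` B).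
Proof.
move=> mA mB; have : comeager (\bigcap_n (if n == 0%N then A else B)).
  by apply: comeager_bigcap => -[].
by apply: comeager_sub => x AB; split; [exact: (AB 0%N)|exact: (AB 1%N)].
Qed.

Definition baire_property A : Prop :=
  exists2 Q, open Q & comeager [set x | A x <-> Q x].

Lemma baire_property_open A : open A -> baire_property A.
Proof.
move=> oA; exists A => //; apply: comeager_sub (comeager_open_dense openT _) => //.
by move=> Q O0 _; rewrite setIT.
Qed.

(** The complement of an open set differs from its own interior only by the boundary of the open
    set, which is nowhere dense. *)
Lemma baire_propertyC A : baire_property A -> baire_property (~` A).
Proof.
move=> [Q oO mA]; exists (~` Q)^°; first exact: open_interior.
have dO : dense (Q `|` (~` Q)^°).
  move=> V V0 oV; case: (pselect (Q `&` V !=set0)) => [[x [Qx Vx]]|OV].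
    by exists x; split=> //; left.
  have [x Vx] := V0; exists x; split=> //; right.
  apply: filterS (open_nbhs_nbhs (conj oV Vx)) => y Vy Qy.
  by apply: OV; exists y.
have := comeagerI mA (comeager_open_dense (openU oO (@open_interior _ _)) dO).
apply: comeager_sub => x [/= AO [Ox|iOx]]; split.
- by move=> /(_ (AO.2 Ox)).
- by move=> /interior_subset/(_ Ox).
- by [].
- by move=> /interior_subset nO /AO.
Qed.

Lemma baire_property_bigcup (A : (set X)^nat) :
  (forall n, baire_property (A n)) -> baire_property (\bigcup_n A n).
Proof.
move=> bA; have /choice[Q OA] : forall n, exists Q, open Q /\
    comeager [set x | A n x <-> Q x] by move=> n; have [Q ? ?] := bA n; exists Q.
exists (\bigcup_n Q n); first by apply: bigcup_open => n _; exact: (OA n).1.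
apply: comeager_sub (comeager_bigcap (fun n => (OA n).2)) => x /= AO.
by split=> -[n _ /(AO n I)]; exists n.
Qed.

End BaireProperty.

(** The sets whose preimage has the Baire property form a sigma-algebra containing the open sets,
    hence all Borel sets. *)
Lemma baire_property_preimage (X Y : topologicalType) (f : X -> Y) (B : set Y) :
  continuous f -> borel B -> baire_property (f @^-1` B).
Proof.
move=> /continuousP cf; apply: (@smallest_sub _ _ _ [set B | baire_property (f @^-1` B)]).
  split => /=.
  - by rewrite preimage_set0; apply: baire_property_open; exact: open0.
  - by move=> A bA; rewrite setTD preimage_setC; exact: baire_propertyC.
  - by move=> A bA; rewrite preimage_bigcup; exact: baire_property_bigcup.
by move=> A oA; apply: baire_property_open; exact: cf.
Qed.

Section BaireReal.
Variable R : realType.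
Implicit Types (A B G Q : set R).

Lemma comeager_shift (e : R) G : comeager G -> comeager [set x | G (x + e)].
Proof.
have ce u : continuous (fun x : R => x + u).
  by move=> x; apply: cvgD; [exact: cvg_id|exact: cvg_cst].
move=> [U [oU UG]]; exists (fun n => (fun x => x + e) @^-1` U n); split=> [n|x Ux].
  split; first by apply: open_comp (oU n).1 => x _; exact: ce.
  move=> V [v Vv] oV.
  have /(_ _ _)[] := (oU n).2 ((fun x => x - e) @^-1` V).
  - by exists (v + e) => /=; rewrite addrK.
  - by apply: open_comp oV => x _; exact: ce.
  by move=> x [/= Vx Ux]; exists (x - e); split; rewrite //= subrK.
exact: UG.
Qed.

Lemma comeager_meets G Q : comeager G -> open Q -> Q !=set0 -> Q `&` G !=set0.
Proof.
move=> [U [oU UG]] oO O0; have [x [Ox Ux]] := Baire oU O0 oO.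
by exists x; split=> //; exact: UG.
Qed.

(* A set with the Baire property fills an open set up to a meager set, so it
   meets its small translates unless it is meager. *)
Lemma baire_property_shift A : baire_property A ->
    (forall d : R, 0 < d -> exists2 e, `|e| < d & forall x, A x -> ~ A (x + e)) ->
  comeager (~` A).
Proof.
move=> [Q oO mO] shA; suff O0 : ~ (Q !=set0).
  by apply: comeager_sub mO => x /= AO /AO Ox; apply: O0; exists x.
move=> [x Ox]; have /nbhs_ballP[d /= d0 dO] := open_nbhs_nbhs (conj oO Ox).
have [e ed eA] := shA d d0.
have xe : nbhs x [set y | Q (y + e)].
  have : nbhs (x + e) Q.
    apply: open_nbhs_nbhs; split=> //; apply: dO.
    by rewrite /ball/= opprD addNKr normrN.
  have ce : (fun y : R => y + e) @ x --> x + e.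
    by apply: cvgD; [exact: cvg_id|exact: cvg_cst].
  exact: ce.
have [V Vx VO] : exists2 V, open_nbhs x V & V `<=` [set y | Q (y + e)].
  by move: xe; rewrite nbhsE.
(* Category yields [y] with [y] and [y + e] both in [Q] such that [A] agrees with [Q] at both; so
   both lie in [A], against the choice of [e]. *)
have [y [[Oy Vy] [/= AO AOe]]] := comeager_meets (comeagerI mO (comeager_shift e mO))
  (openI oO Vx.1) (ex_intro _ x (conj Ox Vx.2)).
by apply: (eA y); [exact/AO|exact/AOe/VO].
Qed.

End BaireReal.

(** * Coordinates and limits in the complex plane *)

Section Coordinates.
Variable R : realType.
Local Notation C := (Cplx R).

Definition pt (x y : R) : C := (x +i* y)%C.

Lemma ptE (z : C) : pt (complex.Re z) (complex.Im z) = z.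
Proof. by case: z. Qed.

Lemma ptD (x y x' y' : R) : pt x y + pt x' y' = pt (x + x') (y + y').
Proof. by []. Qed.

Lemma ptB (x y x' y' : R) : pt x y - pt x' y' = pt (x - x') (y - y').
Proof. by []. Qed.

Lemma ptM (x y x' y' : R) :
  pt x y * pt x' y' = pt (x * x' - y * y') (x * y' + y * x').
Proof. by []. Qed.

Lemma pt_inj (x y x' y' : R) : pt x y = pt x' y' -> x = x' /\ y = y'.
Proof. by case=> -> ->. Qed.

Lemma ler_Re_norm (z : C) : (`|complex.Re z|)%:C%C <= `|z|.
Proof. exact: normc_ge_Re. Qed.

Lemma ler_Im_norm (z : C) : (`|complex.Im z|)%:C%C <= `|z|.
Proof.
case: z => x y; rewrite normc_def lecR /= -sqrtr_sqr ler_sqrt ?addr_ge0 ?sqr_ge0 //.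
by rewrite lerDr sqr_ge0.
Qed.

Lemma norm_pt_le (x y : R) : `|pt x y| <= (`|x| + `|y|)%:C%C.
Proof.
rewrite normc_def lecR /= -[leRHS]ger0_norm ?addr_ge0 // -sqrtr_sqr.
rewrite ler_sqrt ?sqr_ge0 // sqrrD !real_normK ?num_real // lerD2r lerDl.
by rewrite mulrn_wge0 // mulr_ge0.
Qed.

Lemma gt0_CE (e : C) : 0 < e -> e = (complex.Re e)%:C%C /\ 0 < complex.Re e.
Proof. by case: e => x y; rewrite ltcE /= => /andP[/eqP-> ?]. Qed.

Lemma pt_continuous : continuous (fun p : R * R => pt p.1 p.2).
Proof.
move=> [x y]; apply/(@cvgrPdist_lt _ C) => e /gt0_CE[-> e0].
have e2 : 0 < complex.Re e / 2 by rewrite divr_gt0.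
have c1 : (fun p : R * R => p.1) @ (x, y) --> x by exact: cvg_fst.
have c2 : (fun p : R * R => p.2) @ (x, y) --> y by exact: cvg_snd.
move/cvgrPdist_lt: c1 => /(_ _ e2) c1; move/cvgrPdist_lt: c2 => /(_ _ e2) c2.
near=> p; rewrite ptB; apply: le_lt_trans (norm_pt_le _ _) _.
by rewrite ltcR [ltRHS]splitr ltrD //; near: p; [exact: c1|exact: c2].
Unshelve. all: by end_near. Qed.

Lemma Re_continuous : continuous (@complex.Re R : C -> R).
Proof.
move=> z; apply: (cvgrPdist_lt (FF := nbhs_filter z) _ _).2 => e e0.
have /(cvgrPdist_lt (FF := nbhs_filter z))/(_ e%:C%C) : (fun w : C => w) @ z --> z by exact: cvg_id.
rewrite ltcR => /(_ e0); apply: filterS => w; rewrite -ltcR; apply: le_lt_trans.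
have -> : complex.Re z - complex.Re w = complex.Re (z - w).
  by case: z w => [? ?] [? ?].
exact: ler_Re_norm.
Qed.

Lemma Im_continuous : continuous (@complex.Im R : C -> R).
Proof.
move=> z; apply: (cvgrPdist_lt (FF := nbhs_filter z) _ _).2 => e e0.
have /(cvgrPdist_lt (FF := nbhs_filter z))/(_ e%:C%C) : (fun w : C => w) @ z --> z by exact: cvg_id.
rewrite ltcR => /(_ e0); apply: filterS => w; rewrite -ltcR; apply: le_lt_trans.
have -> : complex.Im z - complex.Im w = complex.Im (z - w).
  by case: z w => [? ?] [? ?].
exact: ler_Im_norm.
Qed.

Lemma pt_cvg (T : Type) (F : set_system T) {FF : Filter F} (f g : T -> R) (a b : R) :
  f @ F --> a -> g @ F --> b -> (fun t => pt (f t) (g t)) @ F --> pt a b.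
Proof.
move=> fa gb; have fg : (fun t => (f t, g t)) @ F --> (a, b).
  exact: (cvg_pair (G := nbhs a) (H := nbhs b)).
have ptc : (fun p : R * R => pt p.1 p.2) @ (a, b) --> pt a b := @pt_continuous (a, b).
exact: (cvg_comp _ _ fg ptc).
Qed.

End Coordinates.

Section ComplexLimits.
Context (R : realType) (T : Type) (F : set_system T) {FF : Filter F}.
Local Notation C := (Cplx R).
Implicit Types (f g : T -> C) (a b : C).

Lemma cvgCD f g a b : f @ F --> a -> g @ F --> b ->
  (fun t => f t + g t) @ F --> a + b.
Proof. exact: (@cvgD C C). Qed.

Lemma cvgCB f g a b : f @ F --> a -> g @ F --> b ->
  (fun t => f t - g t) @ F --> a - b.
Proof. exact: (@cvgB C C). Qed.

Lemma cvgCM f g a b : f @ F --> a -> g @ F --> b ->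
  (fun t => f t * g t) @ F --> a * b.
Proof. exact: (@cvgM C). Qed.

Lemma cvgCV f a : a != 0 -> f @ F --> a -> (fun t => (f t)^-1) @ F --> a^-1.
Proof. exact: (@cvgV C). Qed.

Lemma cvgCX f a n : f @ F --> a -> (fun t => f t ^+ n) @ F --> a ^+ n.
Proof.
move=> fa; elim: n => [|n IHn]; first exact: (@cvg_cst C (1 : C) T F FF).
by under eq_fun do rewrite exprS; rewrite exprS; exact: cvgCM.
Qed.

Lemma cvgC_norm f a : f @ F --> a -> (fun t => `|f t|) @ F --> `|a|.
Proof. exact: (@cvg_norm C C). Qed.

Lemma cvgC_dist f a e : 0 < e -> f @ F --> a -> \forall t \near F, `|f t - a| < e.
Proof.
move=> e0 /(cvgrPdist_lt (FF := FF))/(_ _ e0).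
by apply: filterS => t; rewrite distrC.
Qed.

End ComplexLimits.

(** * Continuous square roots up to positive factors *)

Section HalfArguments.
Variable R : realType.
Local Notation C := (Cplx R).

(** This vector bisects the angle between [g] and the positive axis, so it is the principal square
    root of [g] up to a positive factor. It vanishes exactly on the cut [g <= 0], where the order of
    the complex numbers includes being real. *)
Definition hroot (g : C) : C := g + `|g|.

(** Expanding the squared norm of [hroot g] and using that [g] times its conjugate is [|g|^2] shows
    that the quotient equals the squared norm of [hroot g] over [|g|]. *)
Lemma hrootP (g : C) : ~~ (g <= 0) -> 0 < hroot g ^+ 2 / g.
Proof.
move=> g0; have gn0 : g != 0 by apply: contraNneq g0 => ->.
have n0 : `|g| != 0 by rewrite normr_eq0.
have h0 : hroot g != 0.
  apply: contraNneq g0 => /eqP; rewrite addr_eq0 => /eqP->.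
  by rewrite oppr_le0.
have -> : hroot g ^+ 2 / g = `|hroot g| ^+ 2 / `|g|.
  apply/eqP; rewrite eqr_div //; apply/eqP.
  rewrite normCK /hroot rmorphD /= (geC0_conj (normr_ge0 _)).
  have := normCK g; set n := `|g|; set c := g^* => nE.
  have -> : (g + n) ^+ 2 * n = (g + n) * (g * n + n ^+ 2) by ring.
  by rewrite nE; ring.
by rewrite divr_gt0 ?exprn_gt0 ?normr_gt0.
Qed.

Lemma hroot_cvg (T : Type) (F : set_system T) {FF : Filter F} (f : T -> C) (a : C) :
  f @ F --> a -> (fun t => hroot (f t)) @ F --> hroot a.
Proof. by move=> fa; exact: (cvgCD fa (cvgC_norm fa)). Qed.

Lemma near1_nle0 (g : C) : `|g - 1| < 1 -> ~~ (g <= 0).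
Proof.
move=> g1; apply/negP => g0; move: g1; rewrite distrC ger0_norm ?subr_ge0.
  by rewrite gtrBl => /lt_le_trans/(_ g0); rewrite ltxx.
by apply: le_trans g0 _; exact: ler01.
Qed.

Section HalfArg.
Variable X : topologicalType.
Implicit Types (A : set X) (f g s t : X -> C).

(* [s] is, up to positive factors, a continuous square root of [f] on [A]; as
   0^-1 = 0, this forces [f] not to vanish on [A]. *)
Definition half_arg A f s : Prop :=
  (forall x, A x -> s @ within A (nbhs x) --> s x) /\
  (forall x, A x -> 0 < s x ^+ 2 / f x).

Lemma half_arg_neq0 A f s x : half_arg A f s -> A x -> s x != 0 /\ f x != 0.
Proof.
move=> [_ sf] /sf sfx; split; apply: contraTneq sfx => ->.
  by rewrite expr0n mul0r ltxx.
by rewrite invr0 mulr0 ltxx.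
Qed.

Lemma half_argM A f g s t : half_arg A f s -> half_arg A g t ->
  half_arg A (fun x => f x * g x) (fun x => s x * t x).
Proof.
move=> [sc sf] [tc tg]; split=> x Ax; first exact: cvgCM (sc x Ax) (tc x Ax).
by rewrite exprMn invfM mulrACA mulr_gt0 ?sf ?tg.
Qed.

Lemma half_argN A f s : half_arg A f s -> half_arg A f (fun x => - s x).
Proof.
move=> [sc sf]; split=> x Ax; last by rewrite sqrrN sf.
by apply: (@cvgN C C); exact: sc.
Qed.

Lemma eq_half_arg A f g s : {in A, f =1 g} -> half_arg A f s -> half_arg A g s.
Proof. by move=> fg [sc sf]; split=> // x Ax; rewrite -fg ?inE //; exact: sf. Qed.

(** The ratio [g / f] avoids the cut, so [hroot] gives it a continuous square root, which multiplies
    that of [f]. This carries square roots over to small perturbations. *)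
Lemma half_arg_transfer A f g s :
    (forall x, A x -> f @ within A (nbhs x) --> f x) ->
    (forall x, A x -> g @ within A (nbhs x) --> g x) ->
    (forall x, A x -> ~~ (g x / f x <= 0)) -> half_arg A f s ->
  half_arg A g (fun x => s x * hroot (g x / f x)).
Proof.
move=> fc gc gf hs; apply: (@eq_half_arg A (fun x => f x * (g x / f x))).
  by move=> x; rewrite inE => /(half_arg_neq0 hs)[_ f0]; rewrite mulrC divfK.
apply: (half_argM hs); split=> x Ax; last by apply: hrootP; exact: gf.
have [_ f0] := half_arg_neq0 hs Ax.
exact: hroot_cvg (cvgCM (gc x Ax) (cvgCV f0 (fc x Ax))).
Qed.

End HalfArg.

Lemma half_arg_comp (X Y : topologicalType) (A : set X) (B : set Y)
    (f s : X -> C) (h : Y -> X) :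
  continuous h -> (forall y, B y -> A (h y)) -> half_arg A f s ->
  half_arg B (f \o h) (s \o h).
Proof.
move=> hc hBA [sc sf]; split=> y By; last exact/sf/hBA.
apply: (cvg_comp h s) (sc _ (hBA _ By)) => P /= hP.
have Ph : nbhs y [set z | A (h z) -> P (h z)] := hc y _ hP.
by apply: filterS Ph => z Phz Bz; apply: Phz; exact: hBA.
Qed.

Lemma half_arg_cst (X : topologicalType) (A : set X) (c : C) : c != 0 ->
  half_arg A (fun=> c) (fun=> sqrtC c).
Proof.
move=> c0; split=> x _; first exact: (@cvg_cst C).
by rewrite sqrtCK divff ?ltr01.
Qed.

(** The local equivalence makes the part of [A] where [P] holds both open and closed in [A]. *)
Lemma connected_locally_constant (X : topologicalType) (A : set X)
    (P : X -> Prop) : connected A ->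
    (forall x, A x -> \forall y \near x, A y -> (P x <-> P y)) ->
  forall x y, A x -> A y -> P x -> P y.
Proof.
move=> cA locP x y Ax Ay Px; suff PA : A `&` P = A by have [] : (A `&` P) y by rewrite PA.
have inP (Q : X -> Prop) (z : X) : A z -> Q z ->
    (forall x, A x -> \forall y \near x, A y -> (Q x -> Q y)) ->
    ([set y | A y -> Q y])^° z.
  by move=> Az Qz /(_ z Az); apply: filterS => w wQ Aw; exact: wQ.
apply: cA; first by exists x.
- exists ([set y | A y -> P y])^°; first exact: open_interior.
  apply/seteqP; split=> z [Az Pz]; split=> //; last exact: (interior_subset Pz).
  by apply: inP => // w /locP; apply: filterS => v Pwv Av; exact: (Pwv Av).1.
- exists (~` ([set y | A y -> ~ P y])^°); first exact/open_closedC/open_interior.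
  apply/seteqP; split=> z [Az Pz]; split=> //; first by move=> /interior_subset/(_ Az).
  apply: contrapT => nPz; apply: Pz; apply: (inP (fun z => ~ P z)) => // w /locP.
  by apply: filterS => v Pwv Av nPw /((Pwv Av).2).
Qed.

End HalfArguments.

(** * Continuous square roots and homotopy *)

Section Signs.
Variable R : realType.
Local Notation C := (Cplx R).
Implicit Types X : topologicalType.

Lemma near1_gt0 (z : C) : z \is Num.real -> `|z - 1| < 1 -> 0 < z.
Proof.
move=> zr /near1_nle0 z0; rewrite real_ltNge ?real0 //.
Qed.

(** Existence of a square root is locally constant in the parameter: by compactness of [K], for [m]
    near [l] the ratio [f m / f l] stays within 1 of 1 on all of [K], hence off the cut. *)
Lemma half_arg_homotopy X (K : set X) (f : R -> X -> C) :
    compact K -> continuous (fun p : R * X => f p.1 p.2) ->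
    (forall l x, `[0, 1]%classic l -> K x -> f l x != 0) ->
  (exists s, half_arg K (f 0) s) -> exists s, half_arg K (f 1) s.
Proof.
move=> cK cf f0.
have fc l x : f l @ within K (nbhs x) --> f l x.
  apply: cvg_within_filter.
  have lc : (fun y : X => (l, y)) @ x --> (l, x).
    by apply: (cvg_pair (G := nbhs l) (H := nbhs x)); [exact: cvg_cst|exact: cvg_id].
  exact: (cvg_comp _ _ lc (cf (l, x))).
apply: (connected_locally_constant (P := fun l => exists s, half_arg K (f l) s)
  (@segment_connected R 0 1)); rewrite /= ?in_itv /= ?lexx ?ler01 // => l l01.
have close : \forall m \near l, K `<=` (fun x => `|f m x / f l x - 1| < 1).
  apply: ((compact_near_coveringP K).1 cK R (nbhs l)
    (fun m x => `|f m x / f l x - 1| < 1) (nbhs_filter l)) => x Kx.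
  have ratio : (fun p : X * R => f p.2 p.1 / f l p.1) @ (x, l) --> f l x / f l x.
    have c1 : (fun p : X * R => p.1) @ (x, l) --> x by exact: cvg_fst.
    have c2 : (fun p : X * R => p.2) @ (x, l) --> l by exact: cvg_snd.
    have c3 : (fun p : X * R => (p.2, p.1)) @ (x, l) --> (l, x).
      exact: (cvg_pair (G := nbhs l) (H := nbhs x)).
    have c4 : (fun p : X * R => (l, p.1)) @ (x, l) --> (l, x).
      by apply: (cvg_pair (G := nbhs l) (H := nbhs x)); [exact: cvg_cst|].
    apply: cvgCM; first exact: (cvg_comp _ _ c3 (cf (l, x))).
    apply: cvgCV; first exact: f0.
    exact: (cvg_comp _ _ c4 (cf (l, x))).
  rewrite divff in ratio; last exact: f0.
  exact: (cvgC_dist ltr01 ratio).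
apply: filterS close => m close _; split=> -[s hs].
  exists (fun x => s x * hroot (f m x / f l x)).
  by apply: half_arg_transfer hs => x Kx //; exact/near1_nle0/close.
exists (fun x => s x * hroot (f l x / f m x)).
apply: half_arg_transfer hs => x Kx //.
by rewrite -invf_div invr_le0; exact/near1_nle0/close.
Qed.

(** The rectangle is star-shaped about the point [(0, c)]; contracting it there is a homotopy from a
    nonzero constant, whose square root is explicit. *)
Lemma rectangle_half_arg (H : C -> C) (a b c d : R) : continuous H ->
    a <= 0 <= b -> c <= d ->
    (forall x y, `[a, b]%classic x -> `[c, d]%classic y -> H (pt x y) != 0) ->
  exists s : R * R -> C, half_arg (`[a, b]%classic `*` `[c, d]%classic)
    (fun p => H (pt p.1 p.2)) s.
Proof.
move=> cH /andP[a0 b0] cd H0.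
pose f (l : R) (p : R * R) := H (pt (l * p.1) (c + l * (p.2 - c))).
have -> : (fun p => H (pt p.1 p.2)) = f 1.
  by apply/funext => p; rewrite /f !mul1r subrKC.
apply: half_arg_homotopy.
- by apply: compact_setX; exact: segment_compact.
- move=> [l [x y]].
  have c1 : (fun q : R * (R * R) => q.1) @ (l, (x, y)) --> l by exact: cvg_fst.
  have c2 : (fun q : R * (R * R) => q.2) @ (l, (x, y)) --> (x, y) by exact: cvg_snd.
  have c3 : (fun q : R * (R * R) => q.2.1) @ (l, (x, y)) --> x.
    exact: (cvg_comp _ _ c2 cvg_fst).
  have c4 : (fun q : R * (R * R) => q.2.2) @ (l, (x, y)) --> y.
    exact: (cvg_comp _ _ c2 cvg_snd).
  have c5 : (fun q : R * (R * R) => pt (q.1 * q.2.1) (c + q.1 * (q.2.2 - c)))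
      @ (l, (x, y)) --> pt (l * x) (c + l * (y - c)).
    exact: (pt_cvg (cvgM c1 c3) (cvgD (cvg_cst c) (cvgM c1 (cvgB c4 (cvg_cst c))))).
  exact: (cvg_comp _ H c5 (cH _)).
- move=> l [x y] /=; rewrite !in_itv /= => /andP[l0 l1] [/andP[ax xb] /andP[cy yd]].
  apply: H0; rewrite /= in_itv /=; apply/andP; split; nra.
- exists (fun=> sqrtC (H (pt 0 c))).
  have -> : f 0 = fun=> H (pt 0 c).
    by apply/funext => p; rewrite /f !mul0r addr0.
  by apply/half_arg_cst/H0; rewrite /= in_itv /= ?a0 ?lexx.
Qed.

(** The square of [s / t] is the quotient of the positive numbers [s^2 / f] and [t^2 / f]. *)
Lemma half_arg_real X (A : set X) (f s t : X -> C) x :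
  half_arg A f s -> half_arg A f t -> A x ->
  s x / t x != 0 /\ s x / t x \is Num.real.
Proof.
move=> hs ht Ax; have [s0 f0] := half_arg_neq0 hs Ax.
have [t0 _] := half_arg_neq0 ht Ax; split; first by rewrite mulf_neq0 ?invr_eq0.
rewrite realEsqr expr_div_n; have := divr_gt0 (hs.2 _ Ax) (ht.2 _ Ax).
by rewrite invfM mulrACA invrK mulVf // mulr1 => /ltW.
Qed.

(** The quotient [s / t] is continuous, real and nonzero, so its sign is constant on a connected
    set. Replacing [s] by [- s] reduces to the positive case. *)
Lemma half_arg_ratio X (A : set X) (f s t : X -> C) x y : connected A ->
    half_arg A f s -> half_arg A f t -> A x -> A y ->
  0 < (s x / t x) / (s y / t y).
Proof.
move=> cA; wlog : s / 0 < s x / t x => [hw|sx] hs ht Ax Ay.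
  have [q0 qr] := half_arg_real hs ht Ax.
  move: q0; rewrite real_neqr_lt ?real0 // => /orP[] q0; last exact: hw.
  have := hw (fun x => - s x) _ (half_argN hs) ht Ax Ay.
  by rewrite !mulNr invrN mulrN opprK; apply; rewrite oppr_gt0.
apply: divr_gt0 => //.
pose P z := 0 < s z / t z.
apply: (connected_locally_constant (P := P) cA _ Ax Ay sx) => z Az.
have [q0 qr] := half_arg_real hs ht Az; have [t0 _] := half_arg_neq0 ht Az.
have ratio : (fun v => (s v / t v) / (s z / t z)) @ within A (nbhs z) --> (s z / t z) / (s z / t z).
  apply: cvgCM; last exact: cvg_cst.
  exact: cvgCM (hs.1 _ Az) (cvgCV t0 (ht.1 _ Az)).
rewrite divff // in ratio.
have close : nbhs z [set v | A v -> `|s v / t v / (s z / t z) - 1| < 1].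
  exact: cvgC_dist ltr01 ratio.
apply: filterS close => v close Av; rewrite /P.
have : 0 < (s v / t v) / (s z / t z).
  by apply: near1_gt0 (close Av); rewrite rpred_div // (half_arg_real hs ht Av).2.
move=> q; split=> pos; first by rewrite -[ltRHS](divfK q0) mulr_gt0.
by have := divr_gt0 pos q; rewrite invf_div mulrC divfK // gt_eqF.
Qed.

End Signs.

(** * Parity of winding numbers *)

Section ParityOfZeros.
Variable R : realType.
Local Notation C := (Cplx R).
Implicit Types (F f g : C -> C) (e : bool).

(** Signs are booleans, [true] for negative, so that products of signs become exclusive or. In the
    complex order the inequality also makes [z] real. *)
Definition has_sign e (z : C) : bool := 0 < (-1) ^+ e * z.

Lemma has_signF (z : C) : has_sign false z = (0 < z).
Proof. by rewrite /has_sign expr0 mul1r. Qed.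

Lemma has_signM e1 e2 (z w : C) : has_sign e1 z -> has_sign e2 w ->
  has_sign (e1 (+) e2) (z * w).
Proof. by move=> z0 w0; rewrite /has_sign signr_addb mulrACA mulr_gt0. Qed.

Lemma has_signV e (z : C) : has_sign e z -> has_sign e z^-1.
Proof. by rewrite /has_sign -[in X in X -> _]invr_gt0 invfM invr_sign. Qed.

Lemma has_sign_uniq e1 e2 (z : C) : has_sign e1 z -> has_sign e2 z -> e1 = e2.
Proof.
case: e1 e2 => -[] //; rewrite /has_sign ?expr1 ?expr0 ?mulN1r ?mul1r oppr_gt0.
  by move=> /lt_trans h /h; rewrite ltxx.
by move=> z0 /(lt_trans z0); rewrite ltxx.
Qed.

Lemma real_has_sign (z : C) : z != 0 -> z \is Num.real -> exists e, has_sign e z.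
Proof.
move=> z0 zr; move: z0; rewrite real_neqr_lt ?real0 // => /orP[] z0.
  by exists true; rewrite /has_sign expr1 mulN1r oppr_gt0.
by exists false; rewrite /has_sign expr0 mul1r.
Qed.

Local Notation h := (2^-1 : R).

(* The parity of the winding number around 0 of a loop x |-> F(x + i y) with
   F(-1/2 + i y) = F(1/2 + i y): it is even iff a continuous square root along
   the loop closes up. *)
Definition level_sign F (y : R) e : Prop := exists s : R -> C,
  half_arg `[- h, h] (fun x => F (pt x y)) s /\ has_sign e (s h / s (- h)).

Let h_gt0 : 0 < h. Proof. by rewrite invr_gt0. Qed.
Let hin : `[- h, h]%classic h.
Proof. by rewrite /= in_itv /= lexx andbT ge0_cp // ltW. Qed.
Let Nhin : `[- h, h]%classic (- h).
Proof. by rewrite /= in_itv /= lexx /= ge0_cp // ltW. Qed.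

(** Two square roots along the level have a quotient of constant sign, so their end-to-end ratios
    differ by a positive factor. *)
Lemma level_sign_uniq F y e1 e2 : level_sign F y e1 -> level_sign F y e2 -> e1 = e2.
Proof.
move=> [s [hs s1]] [t [ht t2]].
have := half_arg_ratio (@segment_connected R (- h) h) hs ht hin Nhin.
have [s0 _] := half_arg_neq0 hs Nhin; have [t0 _] := half_arg_neq0 ht hin.
have [t0' _] := half_arg_neq0 ht Nhin.
rewrite -has_signF => q; apply: (has_sign_uniq s1).
rewrite -[e2]addbF (_ : s h / s (- h) =
  (t h / t (- h)) * ((s h / t h) / (s (- h) / t (- h)))); last first.
  by field; rewrite t0 t0' s0.
exact: has_signM.
Qed.

Lemma level_sign_exists F y : continuous F -> F (pt h y) = F (pt (- h) y) ->
    (forall x, - h <= x <= h -> F (pt x y) != 0) ->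
  exists e, level_sign F y e.
Proof.
move=> cF Fh F0.
(* The level is treated as a rectangle of height zero. *)
have [|||s hs] := @rectangle_half_arg R F (- h) h y y cF; rewrite ?lexx //.
- by rewrite oppr_le0 ltW.
- move=> x z; rewrite /= !in_itv /= => xh /andP[yz zy].
  by rewrite (_ : z = y) ?F0 //; apply/le_anti/andP.
have hs' : half_arg `[- h, h] (fun x => F (pt x y)) (fun x => s (x, y)).
  apply: (half_arg_comp (h := fun x => (x, y))) hs.
    by move=> x; apply: (cvg_pair (G := nbhs x) (H := nbhs y)); [exact: cvg_id|exact: cvg_cst].
  by move=> x xh; split=> //=; rewrite in_itv /= lexx.
have [s0 f0] := half_arg_neq0 hs' hin; have [s0' _] := half_arg_neq0 hs' Nhin.
suff [e se] : exists e, has_sign e (s (h, y) / s (- h, y)) by exists e, (fun x => s (x, y)).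
apply: real_has_sign; first by rewrite mulf_neq0 ?invr_eq0.
rewrite realEsqr expr_div_n; have := divr_gt0 (hs'.2 _ hin) (hs'.2 _ Nhin).
by rewrite -Fh invfM mulrACA invrK mulVf // mulr1 => /ltW.
Qed.

Variables (c d : R).
Hypothesis cd : c < d.

Let cin : `[c, d]%classic c. Proof. by rewrite /= in_itv /= lexx ltW. Qed.
Let din : `[c, d]%classic d. Proof. by rewrite /= in_itv /= lexx ltW. Qed.

(* [t], [b], [r], [l]: half-arguments on the top, bottom, right and left sides
   of [-1/2, 1/2] x [c, d]. The mismatch [e] at the bottom left corner is the
   parity of the winding number of [f] along the boundary, that is, of the
   number of zeros inside. *)
Definition boundary_sign f e : Prop := exists t b r l : R -> C,
  [/\ half_arg `[- h, h] (fun x => f (pt x d)) t,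
      half_arg `[- h, h] (fun x => f (pt x c)) b,
      half_arg `[c, d] (fun y => f (pt h y)) r &
      half_arg `[c, d] (fun y => f (pt (- h) y)) l] /\
  [/\ has_sign false (t h / r d), has_sign false (t (- h) / l d),
      has_sign false (b h / r c) & has_sign e (b (- h) / l c)].

Lemma boundary_signM f g e1 e2 : boundary_sign f e1 -> boundary_sign g e2 ->
  boundary_sign (fun z => f z * g z) (e1 (+) e2).
Proof.
move=> [t [b [r [l [[ht hb hr hl] [s1 s2 s3 s4]]]]]].
move=> [t' [b' [r' [l' [[ht' hb' hr' hl'] [s1' s2' s3' s4']]]]]].
exists (fun x => t x * t' x), (fun x => b x * b' x), (fun x => r x * r' x),
  (fun x => l x * l' x).
split; split; [exact: half_argM ht ht'|exact: half_argM hb hb'|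
  exact: half_argM hr hr'|exact: half_argM hl hl'|..]; rewrite -mulf_div.
- exact: has_signM s1 s1'.
- exact: has_signM s2 s2'.
- exact: has_signM s3 s3'.
- exact: has_signM s4 s4'.
Qed.

(** By periodicity [r] and [l] are square roots of the same function, so [r / l] has one sign [e']
    all along the sides. Following the corners, the top level has sign [e'] and the bottom level
    [e' (+) e]. *)
Lemma boundary_level_sign f e e0 e1 :
    (forall y, c <= y <= d -> f (pt h y) = f (pt (- h) y)) ->
    boundary_sign f e -> level_sign f c e0 -> level_sign f d e1 ->
  e1 = e0 (+) e.
Proof.
move=> fh [t [b [r [l [[ht hb hr hl] [s1 s2 s3 s4]]]]]] f0 f1.
have hl' : half_arg `[c, d] (fun y => f (pt h y)) l.
  by apply: eq_half_arg hl => y; rewrite inE /= in_itv /= => /fh.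
have [rl0 rlr] := half_arg_real hr hl' din.
have [e' se'] := real_has_sign rl0 rlr.
have sc' : has_sign e' (r c / l c).
  have := half_arg_ratio (@segment_connected R c d) hr hl' cin din.
  by rewrite -has_signF => /(has_signM se'); rewrite addbF mulrC divfK.
have [rc0 _] := half_arg_neq0 hr cin; have [lc0 _] := half_arg_neq0 hl cin.
have [rd0 _] := half_arg_neq0 hr din; have [ld0 _] := half_arg_neq0 hl din.
have [t0 _] := half_arg_neq0 ht Nhin; have [b0 _] := half_arg_neq0 hb Nhin.
have -> : e1 = e'.
  apply: level_sign_uniq f1 _; exists t; split=> //.
  have := has_signM (has_signM s1 (has_signV s2)) se'.
  by congr has_sign; field; rewrite t0 rd0 ld0 ?ht0 ?hl0.
suff -> : e0 = e' (+) e by rewrite -addbA addbb addbF.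
apply: level_sign_uniq f0 _; exists b; split=> //.
have := has_signM (has_signM s3 (has_signV s4)) sc'.
by rewrite /= addbC; congr has_sign; field; rewrite b0 rc0 lc0.
Qed.

(** A single square root on the whole rectangle restricts to the four sides and matches at every
    corner. *)
Lemma boundary_sign_nonvanishing f : continuous f ->
    (forall x y, - h <= x <= h -> c <= y <= d -> f (pt x y) != 0) ->
  boundary_sign f false.
Proof.
move=> cf f0.
have [|||s hs] := @rectangle_half_arg R f (- h) h c d cf;
  rewrite ?(ltW cd) //.
- by rewrite oppr_le0 ltW.
have pairl (u : R) : continuous (fun x : R => (x, u)).
  by move=> x; apply: (cvg_pair (G := nbhs x) (H := nbhs u)); [exact: cvg_id|exact: cvg_cst].
have pairr (u : R) : continuous (fun x : R => (u, x)).
  by move=> x; apply: (cvg_pair (G := nbhs u) (H := nbhs x)); [exact: cvg_cst|exact: cvg_id].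
have ss x y : `[- h, h]%classic x -> `[c, d]%classic y -> has_sign false (s (x, y) / s (x, y)).
  move=> xh ycd; have [s0 _] := half_arg_neq0 hs (conj xh ycd : (_ `*` _) (x, y)).
  by rewrite /has_sign expr0 mul1r divff // ltr01.
exists (fun x => s (x, d)), (fun x => s (x, c)), (fun y => s (h, y)), (fun y => s (- h, y)).
split; split; try exact: ss.
- by apply: (half_arg_comp (h := fun x => (x, d))) hs.
- by apply: (half_arg_comp (h := fun x => (x, c))) hs.
- by apply: (half_arg_comp (h := fun y => (h, y))) hs.
- by apply: (half_arg_comp (h := fun y => (- h, y))) hs.
Qed.

End ParityOfZeros.

(** * The contribution of one linear factor *)

Section Factorization.
Variable R : realType.
Local Notation C := (Cplx R).
Implicit Types (F G H : C -> C) (a z w : C).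

(** Multiplying by [v] rotates the cut away from the values of [f], and [u], a square root of the
    inverse of [v], undoes the rotation. *)
Lemma half_arg_branch (X : topologicalType) (A : set X) (f : X -> C) (u v : C) :
    u ^+ 2 * v = 1 -> continuous f -> (forall x, A x -> ~~ (v * f x <= 0)) ->
  half_arg A f (fun x => u * hroot (v * f x)).
Proof.
move=> uv fc fA; split=> x Ax.
  apply: cvg_within_filter; apply: cvgCM; first exact: cvg_cst.
  by apply: hroot_cvg; apply: cvgCM; [exact: cvg_cst|exact: fc].
have v0 : v != 0.
  by apply: contra_eq_neq uv => ->; rewrite mulr0 eq_sym oner_eq0.
rewrite (_ : _ / f x = hroot (v * f x) ^+ 2 / (v * f x)); first exact/hrootP/fA.
by rewrite exprMn invfM -[u ^+ 2](mulfK v0) uv mul1r; ring.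
Qed.

(** Multiply by the conjugate of the denominator: the imaginary terms in [|w|^2] cancel. The
    quotient of the two branches thus has the sign of the real part of [w]. *)
Lemma branch_ratio w : `|w| - 'i * w != 0 ->
  (- 'i * (`|w| + 'i * w)) / (`|w| - 'i * w) =
  `|w| * (w + w^*) / `| `|w| - 'i * w| ^+ 2.
Proof.
move=> g0; apply/eqP; rewrite eqr_div ?expf_neq0 ?normr_eq0 //; apply/eqP.
rewrite normCK rmorphB rmorphM /= (geC0_conj (normr_ge0 _)) conjCi.
rewrite mulrA [RHS]mulrC [X in X * _]mulrC -!mulrA; congr (_ * _).
have := normCK w; set n := `|w|; set c := w^* => nE.
rewrite (_ : _ * _ = - 'i * n ^+ 2 - 'i ^+ 2 * n * (w + c) - 'i ^+ 2 * 'i * (w * c)).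
  by rewrite -nE sqrCi; ring.
by ring.
Qed.

Local Notation h := (2^-1 : R).

(** The top and lateral sides avoid the ray going down from the zero, the bottom side avoids the ray
    going up. Using one branch for the former and another for the latter leaves a single mismatch,
    at the bottom left corner. *)
Lemma boundary_sign_linear (c d x0 y0 : R) : - h < x0 < h -> c < y0 < d ->
  boundary_sign c d (fun z => z - pt x0 y0) true.
Proof.
move=> /andP[hx xh] /andP[cy yd]; pose a := pt x0 y0.
have ptx (y : R) : continuous (fun x => pt x y - a).
  move=> x; apply: cvgCB; last exact: cvg_cst.
  by apply: pt_cvg; [exact: cvg_id|exact: cvg_cst].
have pty (x : R) : continuous (fun y => pt x y - a).
  move=> y; apply: cvgCB; last exact: cvg_cst.
  by apply: pt_cvg; [exact: cvg_cst|exact: cvg_id].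
have iE : 'i = pt 0 1 :> C by rewrite -complexiE.
have iM x y : 'i * (pt x y - a) = pt (- (y - y0)) (x - x0).
  by rewrite iE ptB ptM !(mul0r, mul1r, add0r, sub0r).
have iMN x y : - 'i * (pt x y - a) = pt (y - y0) (- (x - x0)).
  by rewrite mulNr iM -[in RHS](opprK (y - y0)).
have up_cut x y : (x != x0) || (y0 < y) -> ~~ (- 'i * (pt x y - a) <= 0).
  rewrite iMN lecE /= negb_and; case/orP => xy.
    by rewrite eq_sym oppr_eq0 subr_eq0 xy.
  by rewrite subr_le0 -ltNge xy orbT.
have down_cut x y : (x != x0) || (y < y0) -> ~~ ('i * (pt x y - a) <= 0).
  rewrite iM lecE /= negb_and; case/orP => xy.
    by rewrite eq_sym subr_eq0 xy.
  by rewrite oppr_le0 subr_ge0 -ltNge xy orbT.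
have i0 : 'i != 0 :> C by exact: neq0Ci.
(* The factors [u] and [- 'i * u] compensate the rotations by [- 'i] and ['i]; the sign of the
   second is chosen so that the branches agree on the right. *)
pose u : C := sqrtC 'i; have u2 : u ^+ 2 = 'i by rewrite sqrtCK.
have u0 : u != 0 by rewrite sqrtC_eq0.
have uN : u ^+ 2 * - 'i = 1 by rewrite u2 mulrN -expr2 sqrCi opprK.
have vP : (- 'i * u) ^+ 2 * 'i = 1.
  by rewrite exprMn u2 sqrrN sqrCi -mulrA -expr2 sqrCi mulN1r opprK.
(* Two branches of the square root of z - a up to positive factors, cut along the
   rays going down and up from a: they agree to the right of a and are opposite
   to the left of a. *)
pose up (z : C) := u * hroot (- 'i * (z - a)).
pose dn (z : C) := (- 'i * u) * hroot ('i * (z - a)).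
have up0 x y : (x != x0) || (y0 < y) -> hroot (- 'i * (pt x y - a)) != 0.
  move=> /up_cut/hrootP; apply: contraTneq => ->.
  by rewrite expr0n mul0r ltxx.
have upup x y : (x != x0) || (y0 < y) -> has_sign false (up (pt x y) / up (pt x y)).
  by move=> xy; rewrite has_signF divff ?ltr01 // mulf_neq0 ?up0.
have dnup x y : x != x0 -> has_sign (x < x0) (dn (pt x y) / up (pt x y)).
  move=> xx0; have g0 : hroot (- 'i * (pt x y - a)) != 0 by rewrite up0 ?xx0.
  have w0 : pt x y - a != 0.
    by apply: contraNneq (up_cut x y _) => [->|]; rewrite ?mulr0 ?xx0.
  have hE (z k : C) : `|k| = 1 -> hroot (k * z) = `|z| + k * z.
    by move=> k1; rewrite /hroot normrM k1 mul1r addrC.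
  set w := pt x y - a in w0 g0 *.
  have g0' : `|w| - 'i * w != 0 by move: g0; rewrite hE ?normrN ?normCi // mulNr.
  have -> : dn (pt x y) / up (pt x y) = (- 'i * (`|w| + 'i * w)) / (`|w| - 'i * w).
    rewrite /dn /up -/w !hE ?normrN ?normCi // [- 'i * w]mulNr.
    by rewrite [- 'i * u]mulrC -[u * - 'i * _]mulrA -mulf_div divff // mul1r.
  rewrite branch_ratio //.
  have n0 : 0 < `|w| by rewrite normr_gt0.
  have d0 : 0 < `| `|w| - 'i * w| ^+ 2 by rewrite exprn_gt0 ?normr_gt0.
  have -> : w + w^* = (x - x0)%:C%C *+ 2.
    have -> : x - x0 = complex.Re w by [].
    by rewrite complexRe ReE mulr2n -splitr.
  have pos (v : R) : 0 < v -> 0 < (v%:C%C : C) *+ 2.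
    by move=> v0; rewrite mulr2n addr_gt0 // (ltcR 0).
  rewrite /has_sign; case: ltgtP xx0 => // xx0 _; last first.
    by rewrite expr0 mul1r divr_gt0 // mulr_gt0 // pos // subr_gt0.
  rewrite expr1 mulN1r -mulNr -mulrN divr_gt0 // mulr_gt0 // -mulNrn.
  by have := pos (- (x - x0)); rewrite rmorphN /=; apply; rewrite oppr_gt0 subr_lt0.
exists (fun x => up (pt x d)), (fun x => dn (pt x c)),
  (fun y => up (pt h y)), (fun y => up (pt (- h) y)).
have hx0 : h != x0 by rewrite gt_eqF.
have Nhx0 : - h != x0 by rewrite lt_eqF.
split; split.
- by apply: half_arg_branch uN (ptx d) _ => x _; apply: up_cut; rewrite yd orbT.
- by apply: half_arg_branch vP (ptx c) _ => x _; apply: down_cut; rewrite cy orbT.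
- by apply: half_arg_branch uN (pty _) _ => y _; apply: up_cut; rewrite hx0.
- by apply: half_arg_branch uN (pty _) _ => y _; apply: up_cut; rewrite Nhx0.
- by apply: upup; rewrite hx0.
- by apply: upup; rewrite Nhx0.
- by have := dnup h c hx0; rewrite ltNge (ltW xh).
- by have := dnup (- h) c Nhx0; rewrite hx.
Qed.

End Factorization.

(** * Parity of the number of zeros *)

Section ParityTheorem.
Variable R : realType.
Local Notation C := (Cplx R).
Implicit Types (F G H : C -> C) (a z w : C).

(* As [vanishing_order], but with a cofactor that is only required to be
   continuous: this is what survives the division by z - a. *)
Definition continuous_order F a (n : nat) : Prop := exists G,
  [/\ continuous G, G a != 0 & forall z, F z = (z - a) ^+ n * G z].

Lemma vanishing_continuous_order F a n :
  vanishing_order F a n -> continuous_order F a n.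
Proof.
move=> [G [eG Ga FG]]; exists G; split; [|exact: Ga|exact: FG].
by move=> z; apply/differentiable_continuous/derivable1_diffP; exact: eG.
Qed.

Lemma cvg_near_eq (X Y : topologicalType) (f g : X -> Y) (x : X) (y : Y) :
  nbhs x [set u | f u = g u] -> g @ x --> y -> f @ x --> y.
Proof.
move=> fg gy P Py; have gP : nbhs x [set u | P (g u)] := gy P Py.
suff : nbhs x [set u | P (f u)] by [].
by apply: filterS (filterI fg gP) => u [/= ->].
Qed.

Lemma nbhsC_neq a b : b != a -> nbhs b [set z | z != a].
Proof.
move=> ba; apply: open_nbhs_nbhs; split=> //.
have -> : [set z | z != a] = ~` [set a].
  by apply/seteqP; split=> z /=; [move/eqP|move=> /eqP].
by apply/closed_openC/accessible_closed_set1/hausdorff_accessible/norm_hausdorff.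
Qed.

Lemma cvg_subX (b z : C) n : (fun z => (z - b) ^+ n) @ z --> (z - b) ^+ n.
Proof.
have sz : (fun w : C => w - b) @ z --> z - b.
  by apply: (@cvgB C C C (nbhs z) _ (fun w => w) (fun=> b) z b);
    [exact: cvg_id|exact: cvg_cst].
refine (@cvgCX R C (nbhs z) _ (fun w => w - b) (z - b) n sz).
Qed.

(** The new cofactor is [G / (z - b)^n] away from [b] and [K / (z - a)^m] away from [a]. As [a] and
    [b] differ, one of these formulas gives continuity at each point. *)
Lemma continuous_order_cofactor G F a b m n : continuous G ->
    (forall z, F z = (z - a) ^+ m * G z) -> b != a ->
  continuous_order F b n -> continuous_order G b n.
Proof.
move=> cG FG ba [K [cK Kb FK]]; have ba0 : b - a != 0 by rewrite subr_eq0.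
pose L z := if z == b then K b / (b - a) ^+ m else G z / (z - b) ^+ n.
have LE z : z != a -> L z = K z / (z - a) ^+ m.
  rewrite /L -subr_eq0 => za; case: eqVneq => [->//|zb].
  have zb0 : z - b != 0 by rewrite subr_eq0.
  by apply/eqP; rewrite eqr_div ?expf_neq0 // mulrC -FG FK mulrC.
exists L; split=> [z|| z].
- have [->|zb] := eqVneq z b.
    apply: (@cvg_near_eq C C L (fun z => K z / (z - a) ^+ m)).
      by apply: filterS (nbhsC_neq ba) => w wa /=; rewrite LE.
    rewrite LE //; apply: (@cvgCM R C (nbhs b)); first exact: cK.
    by apply: (@cvgCV R C (nbhs b)); [rewrite expf_neq0|exact: cvg_subX].
  apply: (@cvg_near_eq C C L (fun z => G z / (z - b) ^+ n)).
    by apply: filterS (nbhsC_neq zb) => w wb /=; rewrite /L (negPf wb).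
  rewrite /L (negPf zb); apply: (@cvgCM R C (nbhs z)); first exact: cG.
  by apply: (@cvgCV R C (nbhs z)); [rewrite expf_neq0 // subr_eq0|exact: cvg_subX].
- by rewrite LE // mulf_neq0 ?invr_eq0 ?expf_neq0.
- rewrite /L; case: eqVneq => [->|zb]; last first.
    by rewrite mulrC divfK // expf_neq0 // subr_eq0.
  apply: (mulfI (expf_neq0 m ba0)); rewrite -FG FK.
  by rewrite mulrCA [_ ^+ m * _]mulrC divfK // expf_neq0.
Qed.

Lemma continuous_factorization F (L : C -> nat) (s : seq C) : continuous F ->
    (forall a, continuous_order F a (L a)) -> uniq s ->
  exists H, [/\ continuous H,
    forall z, F z = \prod_(a <- s) (z - a) ^+ L a * H z &
    forall a, continuous_order H a (if a \in s then 0%N else L a)].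
Proof.
move=> cF ordF; elim: s => [_|a s IHs /= /andP[as_ /IHs[H [cH FH ordH]]]].
  by exists F; split; [exact: cF|move=> z; rewrite big_nil mul1r|exact: ordF].
have := ordH a; rewrite (negPf as_) => -[G [cG Ga HG]].
exists G; split; [exact: cG|move=> z|move=> b].
  by rewrite big_cons FH HG mulrA [X in X * _]mulrC.
rewrite inE; case: eqVneq => [->|ba] /=.
  by exists G; split; [exact: cG|exact: Ga|move=> z; rewrite expr0 mul1r].
exact: continuous_order_cofactor HG ba (ordH b).
Qed.

Local Notation h := (2^-1 : R).

Lemma boundary_sign1 (c d : R) : c < d -> boundary_sign c d (fun=> 1 : C) false.
Proof.
move=> cd; apply: boundary_sign_nonvanishing => [//||*]; last exact: oner_neq0.
by move=> z; exact: (@cvg_cst C (1 : C) C (nbhs z) _).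
Qed.

Lemma boundary_sign_exp (c d : R) F e n : c < d ->
  boundary_sign c d F e -> boundary_sign c d (fun z => F z ^+ n) (odd n && e).
Proof.
move=> cd bF; elim: n => [|n IHn].
  by under eq_fun do rewrite expr0; exact: boundary_sign1.
rewrite (_ : odd n.+1 && e = e (+) (odd n && e)); last first.
  by rewrite oddS; case: (odd n); rewrite /= ?addbb ?addbF.
by under eq_fun do rewrite exprS; exact: boundary_signM.
Qed.

(** Dividing out the points of [s] leaves a cofactor without zeros in the rectangle, of sign
    [false]; each linear factor counts once per multiplicity, modulo 2. *)
Lemma boundary_sign_parity (c d : R) F (L : C -> nat) (s : seq C) :
    c < d -> continuous F -> (forall a, continuous_order F a (L a)) -> uniq s ->
    (forall a, a \in s -> - h < complex.Re a < h /\ c < complex.Im a < d) ->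
    (forall x y, - h <= x <= h -> c <= y <= d -> L (pt x y) != 0%N -> pt x y \in s) ->
  boundary_sign c d F (odd (\sum_(a <- s) L a)).
Proof.
move=> cd cF ordF us sin sout.
have [H [cH FH ordH]] := continuous_factorization cF ordF us.
have -> : F = (fun z => \prod_(a <- s) (z - a) ^+ L a * H z) by exact/funext.
rewrite -[odd _]addbF; apply: boundary_signM; last first.
  apply: boundary_sign_nonvanishing => // x y xh ycd.
  have := ordH (pt x y); rewrite (_ : (if _ then _ else _) = 0%N); last first.
    by case: ifP => // /negbT; apply: contraNeq => /(sout _ _ xh ycd).
  by move=> [G [_ Gxy ->]]; rewrite expr0 mul1r.
elim: s {us sout FH ordH} sin => [_|a s IHs sin].
  by rewrite big_nil; under eq_fun do rewrite big_nil; exact: boundary_sign1.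
rewrite big_cons oddD; under eq_fun do rewrite big_cons.
apply: boundary_signM; last by apply: IHs => b bs; apply: sin; rewrite inE bs orbT.
rewrite -[odd _]andbT; apply: boundary_sign_exp => //.
have [aR aI] := sin a (mem_head _ _).
by have := boundary_sign_linear aR aI; rewrite ptE.
Qed.

End ParityTheorem.

(** * Integrals with respect to divisors *)

Section FiniteSums.
Variable R : realType.
Local Notation C := (Cplx R).
Implicit Types (L : divisor R) (phi : test_function R) (s : seq C).

(** Agreement with the list is asked on [A] alone: a test function sees the divisor only where it is
    nonzero, and there a finite list suffices. *)
Lemma counting_measure_count L s (A : set C) :
    (forall a, A a -> L a = count_mem a s) ->
  counting_measure L (A : set (borelC R)) = (\sum_(p <- s) (p \in A)%:R%:E)%E.
Proof.
move=> LA; rewrite /counting_measure.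
rewrite (@eq_esum _ _ A _ (fun a => (\sum_(p <- s) (p == a)%:R%:E)%E)); last first.
  move=> a /LA ->; rewrite sumEFin; congr (_ %:E).
  elim: s {LA} => [|p s IHs] /=; first by rewrite big_nil.
  by rewrite big_cons natrD IHs.
rewrite esum_sum; last by move=> a p _ _; rewrite lee_fin ler0n.
apply: eq_bigr => p _; rewrite (esumID [set p]); last first.
  by move=> a _; rewrite lee_fin ler0n.
rewrite [X in (_ + X)%E]esum1 ?adde0; last first.
  by move=> a [_ /= /eqP]; rewrite eq_sym => /negPf ->.
have [pA|pA] := boolP (p \in A).
  rewrite (_ : A `&` [set p] = [set p]); last first.
    by apply/seteqP; split=> [a []//|a -> /=]; split=> //; exact: set_mem.
  by rewrite esum_set1 ?eqxx // lee_fin ler0n.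
rewrite (_ : A `&` [set p] = set0) ?esum_set0 // -subset0 => a [Aa /= ap].
by move: pA; rewrite -ap mem_set.
Qed.

Lemma measurable_test phi : measurable_fun setT (sval phi : borelC R -> R).
Proof.
apply: (measurability _ (RGenOpens.measurableE R)) => _ [_ [a [b ->] <-]].
apply: sub_sigma_algebra; rewrite setTI.
have [cphi _] := svalP phi.
by apply: open_comp => [z _|]; [exact: cphi|exact: interval_open].
Qed.

(** Both integrals live on the set where [phi] is nonzero; there the counting measure coincides with
    the sum [m] of Dirac masses at the points of [s]. *)
Lemma vague_pairingE L s phi :
    (forall z, sval phi z != 0 -> L z = count_mem z s) ->
  vague_pairing L phi = \sum_(p <- s) sval phi p.
Proof.
move=> Ls; pose f (z : borelC R) : \bar R := (sval phi z)%:E.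
pose m : {measure set (borelC R) -> \bar R} :=
  msum (fun k => dirac (nth 0 s k : borelC R)) (size s).
have mf : measurable_fun setT f by apply/measurable_EFinP; exact: measurable_test.
pose D : set (borelC R) := [set z | sval phi z != 0].
have fD : f \_ D = f.
  apply/funext => z; rewrite /patch; case: ifPn => // /negP zD.
  rewrite /f; have [-> //|phiz] := eqVneq (sval phi z) 0.
  by case: zD; rewrite inE.
have sumE (g : borelC R -> \bar R) : measurable_fun setT g -> (forall z, 0 <= g z)%E ->
    (\int[m]_z g z = \sum_(p <- s) g p)%E.
  move=> mg g0; rewrite ge0_integral_measure_sum // (big_nth 0) big_mkord.
  by apply: eq_bigr => k _; rewrite integral_dirac // diracT mul1e.
have mE : (\int[counting_measure L]_z f z = \int[m]_z f z)%E.
  rewrite -fD -!integral_mkcond; apply: eq_measure_integral => A _ AD.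
  transitivity (\sum_(p <- s) (p \in (A : set C))%:R%:E : \bar R)%E.
    by apply: counting_measure_count => a /AD; exact: Ls.
  rewrite /m /= /msum (big_nth 0) big_mkord.
  by apply: eq_bigr => k _; exact/esym/diracE.
rewrite /vague_pairing /Rintegral -/f mE integralE.
(* The sum formula holds for nonnegative functions, so positive and negative parts are summed
   separately and recombined pointwise. *)
rewrite !sumE; [|exact: measurable_funeneg|by []|exact: measurable_funepos|by []].
rewrite /f (eq_bigr (fun p => (Num.max (sval phi p) 0)%:E)); last first.
  by move=> p _; rewrite funeposE -EFin_max.
rewrite [X in (_ - X)%E](eq_bigr (fun p => (Num.max (- sval phi p) 0)%:E)); last first.
  by move=> p _; rewrite funenegE -EFin_max.
rewrite !sumEFin /= -sumrB; apply: eq_bigr => p _.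
move: (sval phi p) => v; rewrite !maxEle oppr_le0.
by case: (ltgtP v 0) => [||->]; rewrite ?subr0 ?sub0r ?opprK ?oppr0.
Qed.

End FiniteSums.

(** * Two incommensurable grids *)

Section CompactBounds.
Variable R : realType.
Local Notation C := (Cplx R).

Lemma compact_coordinates_bounded (K : set C) : compact K ->
  exists M : R, forall z, K z -> `|complex.Re z| <= M /\ `|complex.Im z| <= M.
Proof.
move=> cK.
have bounded (g : C -> R) : continuous g -> exists M : R, forall z, K z -> `|g z| <= M.
  move=> cg; have : compact (g @` K).
    by apply: continuous_compact cK; exact: continuous_subspaceT.
  move=> /compact_bounded[M [_ MK]]; exists (M + 1) => z Kz.
  by apply: MK; [rewrite ltrDl|exists z].
have [M1 M1P] := bounded _ (@Re_continuous R).
have [M2 M2P] := bounded _ (@Im_continuous R).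
exists (Num.max M1 M2) => z Kz.
by split; rewrite le_max ?M1P ?M2P ?orbT.
Qed.

End CompactBounds.

Section TwoGrids.
Variable R : realType.
Local Notation C := (Cplx R).
Local Notation sq := (Num.sqrt 2 : R).
Local Notation isint := (fun x : R => x \is a Num.int).

Lemma sqrt2_gt0 : 0 < sq. Proof. by rewrite sqrtr_gt0. Qed.

Lemma sqrt2_sqr : sq ^+ 2 = 2. Proof. by rewrite sqr_sqrtr. Qed.

(** Irrationality of the square root of 2: in [n^2 = 2 m^2] the exponents of 2 on the two sides have
    different parities. *)
Lemma int_sqrt2_eq0 (x : R) : isint x -> isint (x * sq) -> x = 0.
Proof.
move=> /intrP[m ->] /intrP[n mn]; suff -> : m = 0 by [].
have : (`|n| ^ 2 = 2 * `|m| ^ 2)%N.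
  have : n ^+ 2 = 2 * m ^+ 2.
    apply: (@intr_inj R); rewrite !expr2 !intrM -mn mulrACA -!expr2 sqrt2_sqr.
    by rewrite mulrC.
  by move=> /(congr1 absz); rewrite !expr2 !abszM -!mulnn.
have [->//|m0] := eqVneq m 0; move=> /(congr1 (logn 2)).
rewrite lognM // ?expn_gt0 ?absz_gt0 ?m0 // !lognX (_ : logn 2 2 = 1%N) //.
by move=> /(congr1 odd); rewrite oddM oddD oddM.
Qed.

Definition ints (N : nat) : seq int := [seq k%:Z - N%:Z | k <- iota 0 N.*2.+1].

Lemma mem_ints N (m : int) : (m \in ints N) = (`|m%:~R : R| <= N%:R).
Proof.
rewrite -intr_norm -[N%:R]/(N%:Z%:~R) ler_int; apply/mapP/idP.
  by move=> [k]; rewrite mem_iota => /andP[_ kN] ->; lia.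
move=> mN; exists (absz (m + N%:Z)); last by lia.
by rewrite mem_iota; lia.
Qed.

Lemma uniq_ints N : uniq (ints N).
Proof. by rewrite map_inj_uniq ?iota_uniq // => i j; lia. Qed.

Definition grid (g : R -> R) N : seq C :=
  [seq pt m%:~R (g n%:~R) | m <- ints N, n <- ints N].

Lemma count_grid (g gi : R -> R) N (z : C) : cancel g gi -> cancel gi g ->
    `|complex.Re z| <= N%:R -> `|gi (complex.Im z)| <= N%:R ->
  count_mem z (grid g N) = (isint (complex.Re z) && isint (gi (complex.Im z))).
Proof.
move=> gK giK zRe zIm; rewrite count_uniq_mem; last first.
  apply: allpairs_uniq; [exact: uniq_ints|exact: uniq_ints|].
  move=> [m n] [m' n'] _ _ /= /pt_inj[/intr_inj -> /(can_inj gK)/intr_inj ->//].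
congr nat_of_bool; apply/allpairsP/andP.
  move=> [[m n] [_ _ ->]] /=; rewrite gK.
  by split; apply/intrP; [exists m|exists n].
move=> [/intrP[m zm] /intrP[n zn]]; exists (m, n); rewrite !mem_ints -zm -zn.
by split=> //=; rewrite giK ptE.
Qed.

Definition two_grids_mult (b : R) (z : C) : nat :=
  (isint (complex.Re z) * (isint (complex.Im z) + (isint (complex.Im z * sq - b)%R).*2))%N.

Definition grid_points (b : R) N : seq C :=
  grid id N ++ grid (fun y => (y + b) / sq) N ++ grid (fun y => (y + b) / sq) N.

(** Since the square root of 2 is at most 2, the vertical index of [z] in the second grid is at most
    [2 * M + |b|] in absolute value. Listing that grid twice produces its weight. *)
Lemma two_grids_mult_count (M b : R) N (z : C) :
    `|complex.Re z| <= M -> `|complex.Im z| <= M -> 2 * M + `|b| <= N%:R ->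
  two_grids_mult b z = count_mem z (grid_points b N).
Proof.
move=> zRe zIm MN; have M0 : 0 <= M by apply: le_trans zRe.
have b0 := normr_ge0 b; have sq0 := sqrt2_gt0.
have sq2 : sq <= 2 by have := sqrt2_sqr; nra.
have sqn0 : sq != 0 by rewrite gt_eqF.
rewrite /grid_points count_cat [X in (_ + X)%N]count_cat (@count_grid id id) //; [|lra|lra].
rewrite (@count_grid _ (fun y => y * sq - b)); first last.
- apply: le_trans MN; apply: le_trans (ler_normB _ _) _; rewrite lerD2r.
  rewrite normrM (gtr0_norm sq0) mulrC.
  have := normr_ge0 (complex.Im z); nra.
- lra.
- by move=> y; rewrite subrK mulfK.
- by move=> y; rewrite divfK // addrK.
by rewrite /two_grids_mult addnn; case: (_ \is a _); rewrite /= ?mul0n // mul1n.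
Qed.

Lemma natr_bound (x : R) : exists N : nat, x <= N%:R.
Proof. by exists (Num.trunc x).+1; rewrite ltW // truncnS_gt. Qed.

Lemma two_grids_locally_finite b (K : set C) : compact K ->
  finite_set (K `&` [set z | two_grids_mult b z != 0%N]).
Proof.
move=> /compact_coordinates_bounded[M KM]; have [N MN] := natr_bound (2 * M + `|b|).
apply: (@sub_finite_set _ _ [set` grid_points b N]); last exact: finite_seq.
move=> z [/KM[zRe zIm] /=]; rewrite (two_grids_mult_count zRe zIm MN).
by rewrite -lt0n -has_count => /hasP[y yN /eqP<-].
Qed.

(* (Z + iZ) + 2 (Z + i (Z + b) / sqrt 2): the weight 2 makes the second grid
   invisible modulo 2 and distinguishes it from the first one. *)
Definition two_grids (b : R) : divisor R := Divisor (two_grids_locally_finite b).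

End TwoGrids.

(** * Periods of the two grids and continuity in the parameter *)

Section TwoGridsPeriods.
Variable R : realType.
Local Notation C := (Cplx R).
Local Notation sq := (Num.sqrt 2 : R).
Implicit Types (b : R) (z w : C).

(** Parity isolates the first grid, as [two_grids_gt1] isolates the second; both are thus determined
    by the divisor. *)
Lemma odd_two_grids b z : odd (two_grids b z) =
  (complex.Re z \is a Num.int) && (complex.Im z \is a Num.int).
Proof.
rewrite /= /two_grids_mult; do 2!case: (_ \is a Num.int); rewrite ?mul0n ?mul1n //=.
  by rewrite odd_double.
by rewrite odd_double.
Qed.

Lemma two_grids_gt1 b z : (1 < two_grids b z)%N =
  (complex.Re z \is a Num.int) && (complex.Im z * sq - b \is a Num.int).
Proof. by rewrite /= /two_grids_mult; do 3!case: (_ \is a Num.int). Qed.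

Lemma two_grids_shift b z (m k l : int) :
  two_grids b (z + pt m%:~R k%:~R) = two_grids (b + l%:~R - k%:~R * sq) z :> nat.
Proof.
rewrite /= /two_grids_mult; case: z => x y /=.
rewrite !(rpredDr _ (intr_int _ _)).
have -> : y * sq - (b + l%:~R - k%:~R * sq) = ((y + k%:~R) * sq - b) + (- l)%:~R.
  by rewrite rmorphN /=; ring.
by rewrite (rpredDr _ (intr_int _ _)).
Qed.

(** A period preserves each grid. The first forces integer coordinates, the second makes [Im w]
    times the square root of 2 an integer; so [Im w] is 0. *)
Lemma two_grids_period b w : shiftD w (two_grids b) = two_grids b <->
  complex.Re w \is a Num.int /\ complex.Im w = 0.
Proof.
split=> [bw|[/intrP[m wm] w0]]; last first.
  apply: divisor_eq => z; rewrite -[LHS]/(two_grids b (z + w)).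
  have -> : w = pt m%:~R 0%:~R by rewrite -wm -(ptE w) w0.
  by rewrite (two_grids_shift b z m 0 0) mul0r subr0 addr0.
have bwz z : two_grids b (z + w) = two_grids b z :> nat.
  exact: (congr1 (fun L : divisor R => L z) bw).
have : odd (two_grids b 0) by rewrite odd_two_grids /= rpred0.
rewrite -(bwz 0) add0r odd_two_grids => /andP[wRe wIm]; split=> //.
apply: int_sqrt2_eq0 wIm _.
have sqn0 : sq != 0 by rewrite gt_eqF // sqrt2_gt0.
have : (1 < two_grids b (pt 0 (b / sq)))%N.
  by rewrite two_grids_gt1 /= divfK // subrr !rpred0.
rewrite -bwz two_grids_gt1 => /andP[_]; case: (w) => x y /=.
by rewrite mulrDl divfK // addrAC subrr add0r.
Qed.

Lemma two_grids_one_periodic b : two_grids b \in Dper R.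
Proof.
apply/mem_set; exists 1; first exact: oner_neq0.
have intE (n : int) : 1 *~ n = pt n%:~R 0 :> C.
  by rewrite -[RHS]/((n%:~R)%:C%C) rmorph_int.
apply/seteqP; split=> [w /= /two_grids_period[/intrP[n wn] w0]|_ [n _ <-] /=].
  by exists n => //; rewrite intE -wn -w0 ptE.
by apply/two_grids_period; rewrite intE /= intr_int.
Qed.

Definition two_grids_per b : Dper R := exist _ (two_grids b) (two_grids_one_periodic b).

Lemma shiftD_two_grids_per b (k l : int) :
  shiftDper (pt 0 k%:~R) (two_grids_per b) = two_grids_per (b + l%:~R - k%:~R * sq).
Proof.
apply/val_inj/divisor_eq => z.
by rewrite -[LHS]/(two_grids b (z + pt 0 k%:~R)) (two_grids_shift b z 0 k l).
Qed.

Lemma shiftD_two_grids_per1 b : shiftDper 1 (two_grids_per b) = two_grids_per b.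
Proof. by apply/val_inj/two_grids_period; rewrite /= rpred1. Qed.

Lemma ptws_cvg (U T : Type) (V : topologicalType) (F : set_system T)
    (FF : Filter F) (f : T -> U -> V) (g : U -> V) :
  (forall u, (fun t => f t u) @ F --> g u) ->
  (f : T -> {ptws U -> V}) @ F --> (g : {ptws U -> V}).
Proof.
move=> fg; apply/cvg_sup => u A [_ [[B' oB' <-] gB' BA]].
have FB : F [set t | B' (f t u)] by apply: (fg u); apply: open_nbhs_nbhs.
have FA : F [set t | A (f t)] by apply: filterS FB => t; exact: BA.
exact: FA.
Qed.

Lemma cvg_sum_seq (T I : Type) (F : set_system T) (FF : Filter F) (s : seq I)
    (f : I -> T -> R) (a : I -> R) : (forall i, f i @ F --> a i) ->
  (fun t => \sum_(i <- s) f i t) @ F --> \sum_(i <- s) a i.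
Proof.
move=> fa; elim: s => [|i s IHs].
  by rewrite big_nil; under eq_fun do rewrite big_nil; exact: cvg_cst.
by rewrite big_cons; under eq_fun do rewrite big_cons; exact: cvgD (fa i) IHs.
Qed.

(** For a fixed test function, one [N] serves all parameters within 1 of [b], whence the bound
    [|b| + 1]. The pairing is then a finite sum of values at continuously moving points. *)
Lemma two_grids_continuous : continuous (@two_grids R).
Proof.
apply: (@continuous_comp_initial _ _ _ (@vague_pairing R)) => b.
apply: ptws_cvg => phi; have [cphi cK] := svalP phi.
have [M KM] := compact_coordinates_bounded cK.
have [N MN] := natr_bound (2 * M + (`|b| + 1)).
pose S c := \sum_(p <- grid_points c N) sval phi p.
have pairingE c : `|c| <= `|b| + 1 -> vague_pairing (two_grids c) phi = S c.
  move=> cb; apply: vague_pairingE => z phiz.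
  have [zRe zIm] := KM _ (subset_closure (phiz : [set z | sval phi z != 0] z)).
  by apply: (two_grids_mult_count zRe zIm); apply: le_trans MN; rewrite lerD2l.
apply: (@cvg_near_eq R R _ S).
  have : nbhs b (ball b 1) by exact: nbhsx_ballx.
  apply: filterS => c; rewrite /ball /= distrC => bc; apply: pairingE.
  rewrite -[c](subrK b) addrC; apply: le_trans (ler_normD _ _) _.
  by rewrite lerD2l ltW.
rewrite /comp pairingE ?lerDl //.
have grid_cvg (g : R -> R -> R) : (forall y, g ^~ y @ b --> g b y) ->
    (fun c => \sum_(p <- grid (g c) N) sval phi p) @ b -->
    \sum_(p <- grid (g b) N) sval phi p.
  have sumE (k : R -> R) : \sum_(p <- grid k N) sval phi p =
      \sum_(m <- ints N) \sum_(n <- ints N) sval phi (pt m%:~R (k n%:~R)).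
    by rewrite big_allpairs_dep.
  move=> gc; rewrite sumE; under eq_fun do rewrite sumE.
  apply: cvg_sum_seq => m; apply: cvg_sum_seq => n.
  have := cphi (pt m%:~R (g b n%:~R)); apply: cvg_comp.
  by apply: pt_cvg; [exact: cvg_cst|exact: gc].
have -> : S = fun c => \sum_(p <- grid id N) sval phi p +
    (\sum_(p <- grid (fun y => (y + c) / sq) N) sval phi p +
     \sum_(p <- grid (fun y => (y + c) / sq) N) sval phi p).
  by apply/funext => c; rewrite /S !big_cat.
have g1 := grid_cvg (fun _ y => y) (fun y => cvg_cst y).
have shift_cvg (y : R) : (fun c => (y + c) / sq) @ b --> (y + b) / sq.
  exact: (cvgM (cvgD (cvg_cst y) cvg_id) (cvg_cst sq^-1)).
have g2 := grid_cvg (fun c y => (y + c) / sq) shift_cvg.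
by apply: cvgD; [exact: g1|apply: cvgD; exact: g2].
Qed.

End TwoGridsPeriods.

(** * Change of parity between two levels *)

Section TwoGridsParity.
Variable R : realType.
Local Notation C := (Cplx R).
Local Notation sq := (Num.sqrt 2 : R).
Local Notation h := (2^-1 : R).

Lemma odd_sum_seq (T : eqType) (f : T -> nat) (s : seq T) :
  odd (\sum_(a <- s) f a) = odd (count (odd \o f) s).
Proof.
elim: s => [|a s IHs]; first by rewrite big_nil.
by rewrite big_cons oddD IHs /= oddD oddb.
Qed.

(** The odd powers of [sq - 1] tend to 0 and have the form [k * sq - l] with [k] odd: multiplying by
    [(sq - 1)^2 = 3 - 2 * sq] sends [(k, l)] to [(3k + 2l, 4k + 3l)]. *)
Lemma small_odd_multiple (d : R) : 0 < d ->
  exists k l : nat, odd k /\ `|l%:R - k%:R * sq| < d.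
Proof.
move=> d0; have sq2 := sqrt2_sqr R; have sq0 := sqrt2_gt0 R.
have sq1 : 0 < sq - 1 by nra.
have sq12 : sq - 1 < 1 by nra.
have expE n : exists k l : nat, odd k /\ (sq - 1) ^+ n.*2.+1 = k%:R * sq - l%:R.
  elim: n => [|n [k [l [ok kl]]]]; first by exists 1%N, 1%N; rewrite mul1r.
  exists (3 * k + 2 * l)%N, (4 * k + 3 * l)%N; split; first by lia.
  rewrite doubleS 2!exprS mulrA -expr2 kl (natrD _ (3 * k)) (natrD _ (4 * k)) !natrM.
  have -> : (sq - 1) ^+ 2 = 3 - 2 * sq by rewrite sqrrB1 sq2; ring.
  have -> : (3 - 2 * sq) * (k%:R * sq - l%:R) =
    (3 * k%:R + 2 * l%:R) * sq - 2 * k%:R * sq ^+ 2 - 3 * l%:R by ring.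
  by rewrite sq2; ring.
have /cvgrPdist_lt/(_ _ d0)[n _ /(_ n (leqnn n))] : (fun n => (sq - 1) ^+ n) @ \oo --> 0.
  by apply: cvg_expr; rewrite gtr0_norm.
rewrite /= sub0r normrN => nd; have [k [l [ok kl]]] := expE n.
exists k, l; split=> //; rewrite distrC -kl; apply: le_lt_trans nd.
have pow_ge0 m : 0 <= (sq - 1) ^+ m by rewrite exprn_ge0 // ltW.
rewrite !ger0_norm // ler_iXn2l //.
by rewrite -addnn -addSn leq_addl.
Qed.

Lemma continuous_order_eq0 (F : C -> C) (a : C) n :
  continuous_order F a n -> F a != 0 -> n = 0%N.
Proof.
by case: n => // n [G [_ _ ->]]; rewrite subrr expr0n mul0r eqxx.
Qed.

Lemma int_half_eq0 (x : R) : x \is a Num.int -> - h <= x <= h -> x = 0.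
Proof.
move=> /intrP[m ->] /andP[mh hm].
suff -> : m = 0 by [].
have : ((-1)%:~R < m%:~R :> R) /\ (m%:~R < 1%:~R :> R).
  by rewrite rmorphN /=; split; lra.
by rewrite !ltr_int; lia.
Qed.

(** Between the two levels the points of odd multiplicity are the [k] points of [row]; those of
    [rest] have even multiplicity. The sum of multiplicities is therefore odd. *)
Lemma two_grids_level_sign (b : R) (F : C -> C) (k : nat) e0 e1 : odd k ->
    continuous F -> (forall z, F (z + 1) = F z) ->
    (forall a, continuous_order F a (two_grids b a)) ->
    level_sign F h e0 -> level_sign F (h + k%:R) e1 ->
  e1 = ~~ e0.
Proof.
move=> ok cF F1 ordF s0 s1; rewrite -[RHS]addbT.
have k0 : (0 < k)%N by case: k ok {s1}.
have kR : h < h + k%:R by rewrite ltrDl ltr0n.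
have [t0 [ht0 _]] := s0; have [t1 [ht1 _]] := s1.
(* A level that has a sign carries no zeros, which keeps all zeros off the horizontal sides. *)
have L0 x : - h <= x <= h -> two_grids b (pt x h) = 0%N :> nat.
  move=> xh; apply: continuous_order_eq0 (ordF _) _.
  by have [] := @half_arg_neq0 _ _ _ _ _ x ht0; rewrite /= ?in_itv.
have L1 x : - h <= x <= h -> two_grids b (pt x (h + k%:R)) = 0%N :> nat.
  move=> xh; apply: continuous_order_eq0 (ordF _) _.
  by have [] := @half_arg_neq0 _ _ _ _ _ x ht1; rewrite /= ?in_itv.
pose M := h + k%:R; have [N MN] := natr_bound (2 * M + `|b|).
pose row := [seq pt 0 j%:R | j <- iota 1 k] : seq C.
pose inside (a : C) := (- h < complex.Re a < h) && (h < complex.Im a < h + k%:R).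
pose rest := [seq a <- undup (grid_points b N) | inside a && ~~ odd (two_grids b a)].
have oddL (a : C) : a \in row -> odd (two_grids b a).
  move=> /mapP[j _ ->]; rewrite odd_two_grids /= rpred0.
  by rewrite -[j%:R]/(j%:Z%:~R) intr_int.
have parity : odd (\sum_(a <- row ++ rest) two_grids b a) = true.
  rewrite odd_sum_seq count_cat oddD.
  have -> : count (odd \o two_grids b) row = k.
    have -> : count (odd \o two_grids b) row = size row.
      by apply/eqP; rewrite -all_count; apply/allP => a /oddL.
    by rewrite size_map size_iota.
  have -> : count (odd \o two_grids b) rest = 0%N.
    by apply/eqP; rewrite -leqn0 leqNgt -has_count; apply/hasPn => a;
      rewrite mem_filter => /andP[/andP[]].
  by rewrite ok.
rewrite -parity; apply: (boundary_level_sign kR) s0 s1.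
  move=> y _; rewrite -(F1 (pt (- h) y)); congr F.
  have <- : pt 1 0 = 1 :> C by [].
  by rewrite ptD addr0; congr pt; field.
apply: boundary_sign_parity => //.
- rewrite cat_uniq; apply/and3P; split.
  + by rewrite map_inj_uniq ?iota_uniq // => i j /pt_inj[_ /eqP]; rewrite eqr_nat => /eqP.
  + apply/hasPn => a; rewrite mem_filter => /andP[/andP[_ aL] _].
    by apply: contra aL => /oddL.
  + by rewrite filter_uniq // undup_uniq.
- move=> a; rewrite mem_cat => /orP[/mapP[j]|]; last first.
    by rewrite mem_filter => /andP[/andP[/andP[]]].
  rewrite mem_iota => /andP[j1 jk] -> /=.
  have j1R : 1 <= j%:R :> R by rewrite ler1n.
  have jkR : j%:R <= k%:R :> R by rewrite ler_nat; lia.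
  by split; apply/andP; split; lra.
- move=> x y xh yk Lxy.
  have /andP[xint _] : (complex.Re (pt x y) \is a Num.int) &&
      ((complex.Im (pt x y) \is a Num.int) || (complex.Im (pt x y) * sq - b \is a Num.int)).
    by move: Lxy; rewrite /= /two_grids_mult /=; do 3!case: (_ \is a Num.int).
  have x0 : x = 0 by exact: int_half_eq0 xint xh.
  have yh : h < y.
    rewrite lt_neqAle; have /andP[-> _] := yk; rewrite andbT.
    by apply: contraNneq Lxy => <-; rewrite L0.
  have yhk : y < h + k%:R.
    rewrite lt_neqAle; have /andP[_ ->] := yk; rewrite andbT.
    by apply: contraNneq Lxy => ->; rewrite L1.
  rewrite mem_cat; case oL : (odd (two_grids b (pt x y))).
    move: oL; rewrite odd_two_grids => /andP[_ /intrP[m /= ym]].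
    apply/orP; left; apply/mapP; exists (absz m); last first.
      rewrite x0 /= ym; congr pt.
      have : (0 < m) by rewrite -(ltr_int R) -ym; lra.
      by case: m {ym} => // m _.
    rewrite mem_iota.
    have m0 : (0 < m) by rewrite -(ltr_int R) -ym; lra.
    have mk : m < k.+1%:Z.
      by rewrite -(ltr_int R) -ym -[k.+1%:Z%:~R]/(k.+1%:R) -natr1; lra.
    by clear - m0 mk; lia.
  apply/orP; right; rewrite mem_filter oL mem_undup /inside /= x0 yh yhk !andbT.
  apply/andP; split; first by apply/andP; split; lra.
  have xM : `|x| <= M by rewrite x0 normr0 /M; lra.
  have yM : `|y| <= M by rewrite ger0_norm /M; lra.
  move: Lxy; rewrite /= (two_grids_mult_count (z := pt x y) xM yM MN) x0.
  by rewrite -lt0n -has_count => /hasP[u uN /eqP<-].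
Qed.

End TwoGridsParity.

(** * Borel dependence on the entire function *)

Section LevelSignOpen.
Variable R : realType.
Local Notation C := (Cplx R).
Local Notation h := (2^-1 : R).

Definition close_on_level (F G : C -> C) (y : R) : Prop :=
  forall x, - h <= x <= h -> `|G (pt x y) / F (pt x y) - 1| < 1.

Lemma level_pt_cvg (F : C -> C) (x y : R) : continuous F ->
  (fun x => F (pt x y)) @ x --> F (pt x y).
Proof.
move=> cF; have ptx : (fun x => pt x y) @ x --> pt x y.
  by apply: pt_cvg; [exact: cvg_id|exact: cvg_cst].
exact: (cvg_comp _ _ ptx (cF _)).
Qed.

(** The correcting factor [hroot (G / F)] takes the same value at both ends of the level, so it
    cancels in the end-to-end ratio. *)
Lemma level_sign_close (F G : C -> C) (y : R) (e : bool) :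
    continuous F -> continuous G ->
    F (pt h y) = F (pt (- h) y) -> G (pt h y) = G (pt (- h) y) ->
    close_on_level F G y -> level_sign F y e -> level_sign G y e.
Proof.
move=> cF cG Fh Gh FG [s [hs se]].
exists (fun x => s x * hroot (G (pt x y) / F (pt x y))); split.
  apply: half_arg_transfer hs => x; rewrite /= in_itv /= => xh.
  - by apply: cvg_within_filter; exact: level_pt_cvg.
  - by apply: cvg_within_filter; exact: level_pt_cvg.
  - exact/near1_nle0/FG.
rewrite Fh Gh -mulf_div divff ?mulr1 //.
have hh : - h <= - h <= h by apply/andP; split; lra.
have := hrootP (near1_nle0 (FG _ hh)); apply: contraTneq => ->.
by rewrite expr0n mul0r ltxx.
Qed.

(** On the compact level [|F|] has a positive minimum [g c], and any [G] uniformly within [g c] of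
    [F] there has its ratio to [F] within 1 of 1. *)
Lemma close_on_level_nbhs (F : Efun R) (y : R) :
    (forall x, - h <= x <= h -> Efun_val F (pt x y) != 0) ->
    continuous (Efun_val F) ->
  nbhs F [set G : Efun R | close_on_level (Efun_val F) (Efun_val G) y].
Proof.
move=> F0 cF; set f := Efun_val F in F0 cF *.
pose g (x : R) := complex.Re `|f (pt x y)|.
have gE x : (g x)%:C%C = `|f (pt x y)| by rewrite RRe_real ?normr_real.
have cg : continuous g.
  move=> x; have fx := level_pt_cvg (x := x) (y := y) cF.
  exact: (cvg_comp _ _ (cvgC_norm fx) (@Re_continuous R _)).
have hh : - h <= h by lra.
have [c cin cmin] := EVT_min hh (continuous_subspaceT cg).
have c0 : 0 < g c.
  by rewrite -(ltcR 0) gE normr_gt0 F0 //; move: cin; rewrite in_itv.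
pose K : set C := (fun x => pt x y) @` `[- h, h].
have cK : compact K.
  apply: continuous_compact; last exact: segment_compact.
  apply: continuous_subspaceT => x.
  by apply: pt_cvg; [exact: cvg_id|exact: cvg_cst].
pose E : set (C * C) := [set p | ball p.1 ((g c)%:C%C : C) p.2].
have entE : entourage E.
  by apply: (@entourage_ball _ _ (PosNum (_ : 0 < (g c)%:C%C :> C))); rewrite (ltcR 0).
have fE : nbhs (f : {family compact, C -> C})
    [set G : {family compact, C -> C} | forall x, K x -> E (f x, G x)].
  exact: fam_nbhs.
have : nbhs F (set_val @^-1` [set G : C -> C | forall x, K x -> E (f x, G x)]).
  exact: (@initial_continuous _ _ set_val F).
apply: filterS => G GE x xh; have Fx0 := F0 x xh.
have : E (f (pt x y), Efun_val G (pt x y)) by apply: GE; exists x; rewrite //= in_itv.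
rewrite /E /ball /= => Gf.
rewrite -[X in _ - X](divff Fx0) -mulrBl normrM normfV ltr_pdivrMr ?normr_gt0 //.
rewrite mul1r distrC; apply: lt_le_trans Gf _; rewrite -gE lecR.
by apply: cmin; rewrite in_itv.
Qed.

(** A union of interiors is open in the whole space [Efun], and on functions with equal values at
    the two ends of the level it amounts to [level_sign]. *)
Definition level_sign_set (y : R) (e : bool) : set (Efun R) :=
  \bigcup_(F in [set F : Efun R | level_sign (Efun_val F) y e /\
      Efun_val F (pt h y) = Efun_val F (pt (- h) y)])
    [set G : Efun R | close_on_level (Efun_val F) (Efun_val G) y]^°.

Lemma open_level_sign_set (y : R) (e : bool) : open (level_sign_set y e).
Proof. by apply: bigcup_open => F _; exact: open_interior. Qed.

Lemma Efun_continuous (F : Efun R) : continuous (Efun_val F).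
Proof.
have [eF _] := set_mem (valP F).
by move=> z; apply/differentiable_continuous/derivable1_diffP; exact: eF.
Qed.

Lemma level_sign_setP (y : R) (e : bool) (F : Efun R) :
    Efun_val F (pt h y) = Efun_val F (pt (- h) y) ->
  level_sign_set y e F <-> level_sign (Efun_val F) y e.
Proof.
move=> Fh; split=> [[G [Ge Gh] /interior_subset GF]|Fe].
  exact: level_sign_close (@Efun_continuous G) (@Efun_continuous F) Gh Fh GF Ge.
exists F => //; apply: close_on_level_nbhs; last exact: Efun_continuous.
move=> x xh; have [s [hs _]] := Fe.
by have [] := @half_arg_neq0 _ _ _ _ _ x hs; rewrite /= ?in_itv.
Qed.

End LevelSignOpen.

(** The default value of [Z] is excluded because the divisor has odd multiplicity at 0. *)
Lemma zero_divisor_two_grids (R : realType) (F : Efun R) (b : R) :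
  Z F = two_grids b -> is_zero_divisor (Efun_val F) (two_grids b).
Proof.
move=> ZF; have [[L FL]|nL] := pselect (exists L, is_zero_divisor (Efun_val F) L).
  by rewrite -ZF (ZE FL).
have F0 : Z F = divisor0 R by apply: xgetPN => L FL; apply: nL; exists L.
by have := odd_two_grids b 0; rewrite -ZF F0 /= !rpred0.
Qed.

(** * Contradiction by Baire category *)

Theorem theorem2 (R : realType) :
  ~ exists W : Dper R -> Eper R,
      [/\ borel_map W,
          forall (L : Dper R) (w : Cplx R),
            W (shiftDper w L) = shiftEper w (W L) &
          forall L : Dper R, Z (set_val (W L)) = set_val L].
Proof.
move=> [W [bW WT ZW]].
pose F b := Efun_val (set_val (W (two_grids_per b))).
have cF b : continuous (F b) by exact: Efun_continuous.
have shiftF b w z : Efun_val (set_val (W (shiftDper w (two_grids_per b)))) z = F b (z + w).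
  by rewrite WT.
have F1 b z : F b (z + 1) = F b z by rewrite -shiftF shiftD_two_grids_per1.
have ordF b a : continuous_order (F b) a (two_grids b a).
  apply: vanishing_continuous_order; apply: zero_divisor_two_grids.
  exact: ZW.
have Fh b y : F b (pt 2^-1 y) = F b (pt (- 2^-1) y).
  rewrite -(F1 b (pt (- 2^-1) y)); congr (F b _).
  have <- : pt 1 0 = 1 :> Cplx R by [].
  by rewrite ptD addr0; congr pt; field.
pose A e := [set b | level_sign (F b) 2^-1 e].
have bpA e : baire_property (A e).
  pose S := @level_sign_set R 2^-1 e; have oS : open S by exact: open_level_sign_set.
  (* Measurability of [W] turns the open set [S] into the trace on [Dper] of a Borel set [B] of
     divisors, which is then pulled back along the continuous map [two_grids]. *)
  have [] := bW (set_val @^-1` S).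
    by exists S; [exact: sub_sigma_algebra|rewrite setTI].
  move=> B bB BS; have -> : A e = @two_grids R @^-1` B.
    apply/seteqP; split=> b.
      move=> /(level_sign_setP e (Fh b 2^-1)) Sb.
      have : (W @^-1` (set_val @^-1` S)) (two_grids_per b) by exact: Sb.
      by rewrite -BS => -[].
    move=> Bb; apply/(level_sign_setP e (Fh b 2^-1)).
    have : (W @^-1` (set_val @^-1` S)) (two_grids_per b) by rewrite -BS; split.
    by [].
  exact: baire_property_preimage (@two_grids_continuous R) bB.
have meagerA e : comeager (~` A e).
  apply: baire_property_shift => // d d0.
  have [k [l [ok kld]]] := small_odd_multiple d0.
  (* By equivariance, membership of the translated parameter in [A e] says that [F b] has sign [e]
     at level [1/2 + k]; for odd [k] this contradicts sign [e] at level [1/2]. *)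
  exists (l%:R - k%:R * Num.sqrt 2) => // b Ab Abe.
  have Ak : level_sign (F b) (2^-1 + k%:R) e.
    move: Abe; rewrite /A /= addrA.
    have := shiftD_two_grids_per b k%:Z l%:Z; rewrite -!pmulrn => shE.
    have -> : F (b + l%:R - k%:R * Num.sqrt 2) = fun z => F b (z + pt 0 k%:R).
      by apply/funext => z; rewrite -shiftF shE.
    move=> [s [[sc sF] se]]; exists s; split=> //; split=> // x xh.
    by have := sF x xh; rewrite ptD addr0.
  have := two_grids_level_sign ok (cF b) (F1 b) (ordF b) Ab Ak.
  by case: (e).
(* For [b] in this interval, [sqrt 2 / 2 - b] lies strictly between -1 and 0, so the second grid
   misses the level [1/2], as the first one always does; hence a sign exists there. *)
pose U : set R := `](Num.sqrt 2 / 2), (Num.sqrt 2 / 2 + 1)[%classic.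
have U0 : U !=set0.
  by exists (Num.sqrt 2 / 2 + 2^-1); rewrite /U /= in_itv /=; apply/andP; split; lra.
have oU : open U by exact: interval_open.
have [b [Ub [At Af]]] :=
  comeager_meets (comeagerI (meagerA true) (meagerA false)) oU U0.
have [//|e eA] := level_sign_exists (cF b) (Fh b 2^-1); last first.
  by case: e eA => [/At|/Af].
move=> x xh.
have [G [_ G0 FG]] := ordF b (pt x 2^-1).
rewrite FG subrr expr0n; suff -> : (two_grids b (pt x 2^-1) == 0%N) by rewrite mul1r.
have hN : 2^-1 \isn't a @Num.int R.
  apply/negP => /intrP[m mE].
  have m0 : (0 < m) by rewrite -(ltr_int R) -mE; lra.
  have m1 : (m < 1) by rewrite -(ltr_int R) -mE; lra.
  by clear - m0 m1; lia.
have bN : 2^-1 * Num.sqrt 2 - b \isn't a Num.int.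
  apply/negP => /intrP[m mE]; move: Ub; rewrite /U /= in_itv /= => /andP[b1 b2].
  have m0 : (-1 < m) by rewrite -(ltr_int R) -mE rmorphN /=; lra.
  have m1 : (m < 0) by rewrite -(ltr_int R) -mE; lra.
  by clear - m0 m1; lia.
by rewrite /= /two_grids_mult /= (negPf hN) (negPf bN) muln0.
Qed.
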